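(* Let $\mathbb{F}$ be an algebraically closed field of characteristic $0$, $n\ge 2$ an integer and $\kappa\in\mathbb{F}\setminus\{0\}$. Let $\mathbf{H}_\kappa$ be the rational Cherednik algebra and $\widetilde{\mathbf{H}}_\kappa$ the degenerate double affine Hecke algebra of type $GL_n$. (i) There exists a unique algebra homomorphism $\iota:\mathbf{H}_\kappa\to\widetilde{\mathbf{H}}_\kappa$ such that $$\iota(w)=w\ (w\in\mathfrak{S}_n),\qquad \iota(x_i)=x_i\ (1\le i\le n),\qquad \iota(y_i)=x_i^{-1}\Big(u_i-\sum_{1\le j<i}s_{ji}\Big)\ (1\le i\le n),$$ and moreover $\iota$ is injective. (ii) The algebra embedding $\iota$ extends to an algebra isomorphism $\mathbb{F}[\underline{x}^{\pm1}]\otimes_{\mathbb{F}[\underline{x}]}\mathbf{H}_\kappa\to\widetilde{\mathbf{H}}_\kappa$, whose inverse map $\jmath:\widetilde{\mathbf{H}}_\kappa\to\mathbb{F}[\underline{x}^{\pm1}]\otimes_{\mathbb{F}[\underline{x}]}\mathbf{H}_\kappa$ is defined by $$\jmath(w)=w\ (w\in\mathfrak{S}_n),\qquad \jmath(x_i)=x_i\ (1\le i\le n),\qquad \jmath(u_i)=x_iy_i+\sum_{1\le j<i}s_{ji}\ (1\le i\le n).$$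
   Context: Notation: $\mathfrak{S}_n$ is the symmetric group, $s_{ij}$ the transposition of $i\ne j$, and $s_i=s_{i,i+1}$. Write $\mathbb{F}[\underline{x}]=\mathbb{F}[x_1,\dots,x_n]$, $\mathbb{F}[\underline{x}^{\pm1}]=\mathbb{F}[x_1^{\pm1},\dots,x_n^{\pm1}]$, $\mathbb{F}[\underline{y}]=\mathbb{F}[y_1,\dots,y_n]$, $\mathbb{F}[\underline{u}]=\mathbb{F}[u_1,\dots,u_n]$ (polynomial, resp. Laurent polynomial, rings). The group $\mathfrak{S}_n$ acts on $\mathbb{F}[\underline{x}]$ and $\mathbb{F}[\underline{x}^{\pm1}]$ by permuting the variables, and $\rtimes$ denotes the smash product, so $wx_iw^{-1}=x_{w(i)}$. $\mathbf{H}_\kappa$ is the unital associative $\mathbb{F}$-algebra which is the quotient of the free product of the algebras $\mathbb{F}[\underline{x}]\rtimes\mathfrak{S}_n$ and $\mathbb{F}[\underline{y}]$ by the relations $s_iy_j=y_{s_i(j)}s_i$ ($1\le i\le n-1$, $1\le j\le n$); $[y_i,x_i]=\kappa+\sum_{k\ne i}s_{ik}$; $[y_i,x_j]=-s_{ij}$ for $i\neq j$. $\widetilde{\mathbf{H}}_\kappa$ is the unital associative $\mathbb{F}$-algebra which is the quotient of the free product of the algebras $\mathbb{F}[\underline{x}^{\pm1}]\rtimes\mathfrak{S}_n$ and $\mathbb{F}[\underline{u}]$ by the relations $s_iu_i=u_{i+1}s_i-1$, $s_iu_{i+1}=u_is_i+1$ ($1\le i\le n-1$); $s_iu_j=u_js_i$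 ($j\ne i,i+1$); $[u_i,x_i]=\kappa x_i+\sum_{1\le k<i}x_ks_{ki}+\sum_{i<k\le n}x_is_{ik}$; $[u_i,x_j]=-x_js_{ji}$ for $i>j$; $[u_i,x_j]=-x_is_{ij}$ for $i<j$. The algebra structure of $\mathbf{H}_\kappa$ extends to an algebra structure on $\mathbb{F}[\underline{x}^{\pm1}]\otimes_{\mathbb{F}[\underline{x}]}\mathbf{H}_\kappa$, namely the one for which $f\mapsto f\otimes1$ and $h\mapsto1\otimes h$ are algebra homomorphisms and $(f\otimes1)(1\otimes h)=f\otimes h$ (the localization of $\mathbf{H}_\kappa$ obtained by inverting $x_1,\dots,x_n$). Elements of $\mathbf{H}_\kappa$ and $\mathbb{F}[\underline{x}^{\pm1}]$ are identified with their images in it. *)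

(* Defs.v *)
From HB Require Import structures.
From mathcomp Require Import fingroup perm.
From mathcomp Require Import all_boot all_order all_algebra.
From mathcomp Require Import finmap.
From mathcomp Require Import boolp.
From mathcomp Require Import monalg mpoly.

Set Implicit Arguments.
Unset Strict Implicit.
Unset Printing Implicit Defensive.

Import GRing.Theory.
Local Open Scope ring_scope.
Local Open Scope quotient_scope.

(* Unital associative algebras, possibly zero: the library's algType demands
   1 != 0, which for an algebra given by generators and relations is a
   theorem. *)
Record alg_structure (F : fieldType) (V : lmodType F) := AlgStructure {
  as_one : V;
  as_mul : V -> V -> V;
  as_mulA : associative as_mul;
  as_mul1 : left_id as_one as_mul;
  as_1mul : right_id as_one as_mul;
  as_linl : forall v, linear (as_mul^~ v);
  as_linr : forall v, linear (as_mul v)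
}.

Record pzAlgebra (F : fieldType) := PzAlgebra {
  alg_mod : lmodType F;
  alg_str : alg_structure alg_mod
}.

Definition carrier (F : fieldType) (A : pzAlgebra F) : Type := alg_mod A.
Coercion carrier : pzAlgebra >-> Sortclass.

Section Carrier.
Variables (F : fieldType) (A : pzAlgebra F).

HB.instance Definition _ := GRing.Lmodule.on (carrier A).

Let mul := as_mul (alg_str A).
Lemma as_mulDl : left_distributive mul +%R.
Proof. by move=> a b c; have := as_linl (alg_str A) c 1 a b; rewrite !scale1r. Qed.
Lemma as_mulDr : right_distributive mul +%R.
Proof. by move=> a b c; have := as_linr (alg_str A) a 1 b c; rewrite !scale1r. Qed.

HB.instance Definition _ := GRing.Zmodule_isPzRing.Build (carrier A)
  (as_mulA (alg_str A)) (as_mul1 (alg_str A)) (as_1mul (alg_str A))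
  as_mulDl as_mulDr.

Lemma pzscalerAl (c : F) (a b : A) : c *: (a * b) = (c *: a) * b.
Proof.
have := as_linl (alg_str A) b c a 0; rewrite !addr0 => h.
by have := mul0r b; rewrite /GRing.mul /= => h0; rewrite h h0 addr0.
Qed.
Lemma pzscalerAr (c : F) (a b : A) : c *: (a * b) = a * (c *: b).
Proof.
have := as_linr (alg_str A) a c b 0; rewrite !addr0 => h.
by have := mulr0 a; rewrite /GRing.mul /= => h0; rewrite h h0 addr0.
Qed.
End Carrier.

Definition alg_hom (F : fieldType) (A B : pzAlgebra F) (f : A -> B) : Prop :=
  linear f /\ monoid_morphism f.

Definition commutator (A : pzRingType) (a b : A) : A := a * b - b * a.

Section Quotient.
Variable F : fieldType.

Record submodule (V : lmodType F) := Submodule {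
  sub_mem :> V -> Prop;
  sub_mem0 : sub_mem 0;
  sub_memZD : forall c u v, sub_mem u -> sub_mem v -> sub_mem (c *: u + v)
}.

Section LQuot.
Variables (V : lmodType F) (W : submodule V).

Lemma sub_memD u v : W u -> W v -> W (u + v).
Proof. by move=> Wu Wv; rewrite -[u]scale1r; apply: sub_memZD. Qed.
Lemma sub_memZ c u : W u -> W (c *: u).
Proof.
by move=> Wu; rewrite -[_ *: _]addr0; apply: sub_memZD => //; apply: sub_mem0.
Qed.
Lemma sub_memN u : W u -> W (- u).
Proof. by rewrite -scaleN1r; apply: sub_memZ. Qed.

Definition qrel : rel V := fun u v => `[< W (u - v) >].

Lemma qrel_refl : reflexive qrel.
Proof. by move=> u; apply/asboolP; rewrite subrr; apply: sub_mem0. Qed.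
Lemma qrel_sym u v : qrel u v = qrel v u.
Proof.
by apply/asboolP/asboolP => /sub_memN; rewrite opprB.
Qed.
Lemma qrel_trans : transitive qrel.
Proof.
move=> v u w /asboolP Wuv /asboolP Wvw; apply/asboolP.
by have := sub_memD Wuv Wvw; rewrite addrA subrK.
Qed.
Canonical qrel_equiv := EquivRel qrel qrel_refl qrel_sym qrel_trans.

Definition lquot := {eq_quot qrel}.
HB.instance Definition _ := Choice.on lquot.
HB.instance Definition _ := EqQuotient.on lquot.

Definition qpi (u : V) : lquot := \pi_lquot u.

Lemma qpiP u v : qpi u = qpi v <-> W (u - v).
Proof.
split=> [/eqP|Wuv]; first by rewrite /qpi eqmodE => /asboolP.
by apply/eqmodP/asboolP.
Qed.
Lemma qpi_ind (P : lquot -> Prop) : (forall u, P (qpi u)) -> forall q, P q.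
Proof. by move=> Pq q; rewrite -[q]reprK; apply: Pq. Qed.
Lemma qpi_repr u : W (repr (qpi u) - u).
Proof. by apply/qpiP; rewrite /qpi reprK. Qed.

Definition lq_opp (p : lquot) := qpi (- repr p).
Definition lq_add (p q : lquot) := qpi (repr p + repr q).
Definition lq_scale (c : F) (q : lquot) := qpi (c *: repr q).

Lemma lq_oppE u : lq_opp (qpi u) = qpi (- u).
Proof. by apply/qpiP; rewrite -opprD; apply: sub_memN; apply: qpi_repr. Qed.
Lemma lq_addE u v : lq_add (qpi u) (qpi v) = qpi (u + v).
Proof.
by apply/qpiP; rewrite opprD addrACA; apply: sub_memD; apply: qpi_repr.
Qed.
Lemma lq_scaleE c u : lq_scale c (qpi u) = qpi (c *: u).
Proof. by apply/qpiP; rewrite -scalerBr; apply: sub_memZ; apply: qpi_repr. Qed.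

Lemma lq_addA : associative lq_add.
Proof.
by elim/qpi_ind=> u; elim/qpi_ind=> v; elim/qpi_ind=> w; rewrite !lq_addE addrA.
Qed.
Lemma lq_addC : commutative lq_add.
Proof. by elim/qpi_ind=> u; elim/qpi_ind=> v; rewrite !lq_addE addrC. Qed.
Lemma lq_add0 : left_id (qpi 0) lq_add.
Proof. by elim/qpi_ind=> u; rewrite lq_addE add0r. Qed.
Lemma lq_addN : left_inverse (qpi 0) lq_opp lq_add.
Proof. by elim/qpi_ind=> u; rewrite lq_oppE lq_addE addNr. Qed.
HB.instance Definition _ := GRing.isZmodule.Build lquot
  lq_addA lq_addC lq_add0 lq_addN.

Lemma lq_scaleA c d q : lq_scale c (lq_scale d q) = lq_scale (c * d) q.
Proof. by elim/qpi_ind: q => u; rewrite !lq_scaleE scalerA. Qed.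
Lemma lq_scale1 : left_id 1 lq_scale.
Proof. by elim/qpi_ind=> u; rewrite lq_scaleE scale1r. Qed.
Lemma lq_scaleDr : right_distributive lq_scale +%R.
Proof.
move=> c; elim/qpi_ind=> u; elim/qpi_ind=> v.
by rewrite /GRing.add /= !(lq_scaleE, lq_addE) scalerDr.
Qed.
Lemma lq_scaleDl q : {morph lq_scale^~ q : c d / c + d}.
Proof.
elim/qpi_ind: q => u c d.
by rewrite /GRing.add /= !(lq_scaleE, lq_addE) scalerDl.
Qed.
HB.instance Definition _ := GRing.Zmodule_isLmodule.Build F lquot
  lq_scaleA lq_scale1 lq_scaleDr lq_scaleDl.

Lemma qpi_linear : linear qpi.
Proof.
move=> c u v; rewrite -lq_addE -lq_scaleE; congr (_ + _).
Qed.
End LQuot.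

Record ideal (A : pzAlgebra F) := Ideal {
  ideal_sub :> submodule A;
  ideal_mulMM : forall a b c : A, ideal_sub b -> ideal_sub (a * b * c)
}.

Section AQuot.
Variables (A : pzAlgebra F) (I : ideal A).

Local Notation api := (qpi I).
Definition aq_mul (p q : lquot I) : lquot I := api (repr p * repr q).

Lemma aq_mulE (a b : A) : aq_mul (api a) (api b) = api (a * b).
Proof.
apply/qpiP; set a' := repr _; set b' := repr _.
have -> : a' * b' - a * b = 1 * (a' - a) * b' + a * (b' - b) * 1.
  by rewrite mul1r mulr1 mulrBl mulrBr addrA subrK.
by apply: sub_memD; apply: ideal_mulMM; apply: qpi_repr.
Qed.
Lemma aq_mulA : associative aq_mul.
Proof.
by elim/qpi_ind=> a; elim/qpi_ind=> b; elim/qpi_ind=> c; rewrite !aq_mulE mulrA.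
Qed.
Lemma aq_mul1 : left_id (api 1) aq_mul.
Proof. by elim/qpi_ind=> a; rewrite aq_mulE mul1r. Qed.
Lemma aq_1mul : right_id (api 1) aq_mul.
Proof. by elim/qpi_ind=> a; rewrite aq_mulE mulr1. Qed.
Lemma aq_linl (q : lquot I) : linear (aq_mul^~ q).
Proof.
elim/qpi_ind: q => c d; elim/qpi_ind=> a; elim/qpi_ind=> b.
by rewrite -qpi_linear !aq_mulE -qpi_linear mulrDl pzscalerAl.
Qed.
Lemma aq_linr (q : lquot I) : linear (aq_mul q).
Proof.
elim/qpi_ind: q => c d; elim/qpi_ind=> a; elim/qpi_ind=> b.
by rewrite -qpi_linear !aq_mulE -qpi_linear mulrDr pzscalerAr.
Qed.

Definition aquot : pzAlgebra F :=
  PzAlgebra (AlgStructure aq_mulA aq_mul1 aq_1mul aq_linl aq_linr).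

Definition aquot_pi (a : A) : aquot := api a.

Lemma aquot_pi_alg_hom : alg_hom aquot_pi.
Proof.
split; first exact: qpi_linear.
by split=> // a b; apply/esym/aq_mulE.
Qed.
End AQuot.

Inductive in_span (V : lmodType F) (S : V -> Prop) : V -> Prop :=
| in_span_gen v : S v -> in_span S v
| in_span0 : in_span S 0
| in_spanZD c u v : in_span S u -> in_span S v -> in_span S (c *: u + v).

Definition span_of (V : lmodType F) (S : V -> Prop) : submodule V :=
  Submodule (in_span0 S) (@in_spanZD V S).

Inductive in_ideal (A : pzAlgebra F) (S : A -> Prop) : A -> Prop :=
| in_ideal_gen a : S a -> in_ideal S a
| in_ideal0 : in_ideal S 0
| in_idealD a b : in_ideal S a -> in_ideal S b -> in_ideal S (a + b)
| in_idealM a b c : in_ideal S b -> in_ideal S (a * b * c).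

Lemma in_idealZD (A : pzAlgebra F) (S : A -> Prop) (c : F) u v :
  in_ideal S u -> in_ideal S v -> in_ideal S (c *: u + v).
Proof.
move=> Su Sv; apply: in_idealD => //.
by rewrite -[u]mulr1 -[u]mul1r !pzscalerAl; apply: in_idealM.
Qed.

Definition ideal_of (A : pzAlgebra F) (S : A -> Prop) : ideal A :=
  @Ideal A (Submodule (in_ideal0 S) (@in_idealZD A S)) (@in_idealM A S).

(* [R a b] is read as the relation "a = b" to be imposed.  The quotient and
   its projection are locked together, so that unification does not unfold
   them. *)
Definition quot_data (A : pzAlgebra F) (R : A -> A -> Prop) :
    {Q : pzAlgebra F & A -> Q} :=
  let I := ideal_of (fun r => exists a b, R a b /\ r = a - b) in
  existT (fun Q : pzAlgebra F => A -> Q) (aquot I) (@aquot_pi A I).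

Fact quot_key : unit. Proof. exact: tt. Qed.

Section QuotBy.
Variables (A : pzAlgebra F) (R : A -> A -> Prop).

Definition quot_by : pzAlgebra F := projT1 (locked_with quot_key (quot_data R)).
Definition quot_pi : A -> quot_by := projT2 (locked_with quot_key (quot_data R)).

Lemma quot_pi_alg_hom : alg_hom quot_pi.
Proof.
rewrite /quot_pi /quot_by (unlock [unlockable of locked_with quot_key _]).
exact: aquot_pi_alg_hom.
Qed.
Lemma quot_piP (a b : A) : quot_pi a = quot_pi b <->
  in_ideal (fun r => exists a b, R a b /\ r = a - b) (a - b).
Proof.
rewrite /quot_pi /quot_by (unlock [unlockable of locked_with quot_key _]).
exact: qpiP.
Qed.
Lemma quot_pi_ind (P : quot_by -> Prop) :
  (forall a, P (quot_pi a)) -> forall q, P q.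
Proof.
rewrite /quot_pi /quot_by in P *.
move: P; rewrite (unlock [unlockable of locked_with quot_key _]).
exact: qpi_ind.
Qed.
Lemma quot_pi_rel a b : R a b -> quot_pi a = quot_pi b.
Proof. by move=> Rab; apply/quot_piP/in_ideal_gen; exists a, b. Qed.
End QuotBy.
End Quotient.

Definition pz_of (F : fieldType) (A : algType F) : pzAlgebra F.
Proof.
refine (@PzAlgebra F A (@AlgStructure F A 1 *%R
          (@mulrA A) (@mul1r A) (@mulr1 A) _ _)).
- by move=> v c a b /=; rewrite mulrDl scalerAl.
- by move=> v c a b /=; rewrite mulrDr scalerAr.
Defined.

Section MalgLinear.
Variables (R : nzRingType) (K : choiceType).

Lemma mkmalgU_scale (c : R) (k : K) : << c *g k >> = c *: << k >>.
Proof.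
apply/malgP => k'; rewrite monalg.mcoeffZ !monalg.mcoeffU.
by case: (k == k'); rewrite ?mulr1n ?mulr1 ?mulr0n ?mulr0.
Qed.

Section Extend.
Variables (V : lmodType R) (h : K -> V).

Definition mlin (g : {malg R[K]}) : V := \sum_(k <- monalg.msupp g) monalg.mcoeff k g *: h k.

Lemma mlinE g (d : {fset K}) : fsubset (monalg.msupp g) d ->
  mlin g = \sum_(k <- d) monalg.mcoeff k g *: h k.
Proof.
move=> sgd; rewrite /mlin (big_fset_incl _ sgd) //= => k _ kg.
by rewrite monalg.mcoeff_outdom // scale0r.
Qed.

Lemma mlin_linear : linear mlin.
Proof.
move=> c g1 g2.
pose d := fsetU (monalg.msupp (c *: g1 + g2)) (fsetU (monalg.msupp g1) (monalg.msupp g2)).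
rewrite (@mlinE (c *: g1 + g2) d) ?fsubsetUl //.
rewrite (@mlinE g1 d); last first.
  by rewrite /d fsetUCA fsubsetUl.
rewrite (@mlinE g2 d); last first.
  by rewrite /d fsetUA fsubsetUr.
rewrite scaler_sumr -big_split /=; apply: eq_bigr => k _.
by rewrite monalg.mcoeffD monalg.mcoeffZ scalerDl scalerA.
Qed.
HB.instance Definition _ :=
  GRing.isLinear.Build R {malg R[K]} V *:%R mlin mlin_linear.

Lemma mlinU k : mlin << k >> = h k.
Proof.
rewrite (@mlinE _ [fset k]%fset) ?monalg.msuppU_le // big_seq_fset1 monalg.mcoeffUU.
by rewrite scale1r.
Qed.
End Extend.

Lemma malg_ext (V : lmodType R) (f1 f2 : {malg R[K]} -> V) :
  linear f1 -> linear f2 -> (forall k, f1 << k >> = f2 << k >>) -> f1 =1 f2.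
Proof.
move=> lin1 lin2 eqf g.
pose F1 := GRing.isLinear.Build _ _ _ _ f1 lin1.
pose F2 := GRing.isLinear.Build _ _ _ _ f2 lin2.
pose g1 : {linear {malg R[K]} -> V} := HB.pack f1 F1.
pose g2 : {linear {malg R[K]} -> V} := HB.pack f2 F2.
rewrite -[f1 g]/(g1 g) -[f2 g]/(g2 g) [g]monalgE !linear_sum.
by apply: eq_bigr => k _; rewrite mkmalgU_scale !linearZ /= eqf.
Qed.
End MalgLinear.

Section FreeAlgebra.
Variables (F : fieldType) (X : choiceType).

Lemma malg_scalerAr (c : F) (a b : {malg F[{fmonom X}]}) :
  c *: (a * b) = a * (c *: b).
Proof.
rewrite [a]monalgE mulr_suml mulr_suml scaler_sumr; apply: eq_bigr => k _.
rewrite [b]monalgE mulr_sumr !scaler_sumr mulr_sumr; apply: eq_bigr => l _.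
rewrite [<< monalg.mcoeff l b *g l >>]mkmalgU_scale scalerA -mkmalgU_scale -mkmalgU_scale.
rewrite !malgM_def !fgmulUU ?[<< _ * _ *g _ >>]mkmalgU_scale scalerA.
by rewrite mulrCA.
Qed.

Lemma free_linl (v : {malg F[{fmonom X}]}) : linear ( *%R^~ v).
Proof. by move=> c a b /=; rewrite mulrDl scalerAl. Qed.
Lemma free_linr (v : {malg F[{fmonom X}]}) : linear ( *%R v).
Proof. by move=> c a b /=; rewrite mulrDr malg_scalerAr. Qed.

Definition free_alg : pzAlgebra F :=
  PzAlgebra (AlgStructure (@mulrA _) (@mul1r _) (@mulr1 _)
    free_linl free_linr).

Definition free_gen (x : X) : free_alg := << fmu x >>.
End FreeAlgebra.

(* The free product (coproduct) of two algebras: the free algebra on their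
   disjoint union, modulo the relations making both inclusions algebra
   homomorphisms. *)
Section FreeProduct.
Variables (F : fieldType) (A B : pzAlgebra F).

Local Notation gl a := (@free_gen F (A + B)%type (inl a)).
Local Notation gr b := (@free_gen F (A + B)%type (inr b)).

Inductive free_prod_rel :
    free_alg F (A + B)%type -> free_alg F (A + B)%type -> Prop :=
| fpr_linl c a a' : free_prod_rel (gl (c *: a + a')) (c *: gl a + gl a')
| fpr_mull a a' : free_prod_rel (gl (a * a')) (gl a * gl a')
| fpr_onel : free_prod_rel (gl 1) 1
| fpr_linr c b b' : free_prod_rel (gr (c *: b + b')) (c *: gr b + gr b')
| fpr_mulr b b' : free_prod_rel (gr (b * b')) (gr b * gr b')
| fpr_oner : free_prod_rel (gr 1) 1.

Definition free_prod : pzAlgebra F := quot_by free_prod_rel.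
Definition fp_inl (a : A) : free_prod := quot_pi free_prod_rel (gl a).
Definition fp_inr (b : B) : free_prod := quot_pi free_prod_rel (gr b).

Lemma fp_inl_alg_hom : alg_hom fp_inl.
Proof.
have [lin [one mul]] := quot_pi_alg_hom free_prod_rel.
split; last split; rewrite /fp_inl.
- by move=> c a b; rewrite -lin; apply/quot_pi_rel/fpr_linl.
- by rewrite -one; apply/quot_pi_rel/fpr_onel.
- by move=> a b; rewrite -mul; apply/quot_pi_rel/fpr_mull.
Qed.
Lemma fp_inr_alg_hom : alg_hom fp_inr.
Proof.
have [lin [one mul]] := quot_pi_alg_hom free_prod_rel.
split; last split; rewrite /fp_inr.
- by move=> c a b; rewrite -lin; apply/quot_pi_rel/fpr_linr.
- by rewrite -one; apply/quot_pi_rel/fpr_oner.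
- by move=> a b; rewrite -mul; apply/quot_pi_rel/fpr_mulr.
Qed.
End FreeProduct.

(* Actions of the symmetric group by algebra automorphisms.  The product of
   permutations in the library is (s * t)%g = t \o s, whence the order in
   [pact_comp]. *)
Record perm_action (F : fieldType) (n : nat) (A : algType F) := PermAction {
  pact :> 'S_n -> A -> A;
  pact_alg_hom : forall s, @alg_hom F (pz_of A) (pz_of A) (pact s);
  pact_id : forall a, pact 1%g a = a;
  pact_comp : forall s t a, pact (t * s)%g a = pact s (pact t a)
}.

(* The smash product of A with S_n.  Its elements are the finite sums
   \sum_w f(w) w, stored as f : {ffun 'S_n -> A}, and
   (a s)(b t) = a s(b) (s \o t), where s \o t is (t * s)%g. *)
Section Smash.
Variables (F : fieldType) (n : nat) (A : algType F) (act : perm_action n A).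

Local Notation M := {ffun 'S_n -> A}.

Definition smash_one : M := [ffun w => (w == 1%g)%:R].
Definition smash_mul (f g : M) : M :=
  [ffun w => \sum_(s : 'S_n) f s * act s (g (w * s^-1)%g)].

Let actP s : linear (act s) := (pact_alg_hom act s).1.
Let act1 s : act s 1 = 1 := (pact_alg_hom act s).2.1.
Let actM s a b : act s (a * b) = act s a * act s b :=
  (pact_alg_hom act s).2.2 a b.
Let actD s a b : act s (a + b) = act s a + act s b.
Proof. by have := actP s 1 a b; rewrite !scale1r. Qed.
Let act0 s : act s 0 = 0.
Proof. by apply: (addrI (act s 0)); rewrite -actD !addr0. Qed.
Let act_sum s (I : finType) (h : I -> A) :
  act s (\sum_i h i) = \sum_i act s (h i).
Proof. exact: (big_morph _ (actD s) (act0 s)). Qed.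

Lemma smash_mulA : associative smash_mul.
Proof.
move=> f g h; apply/ffunP => w; rewrite !ffunE.
under eq_bigr => s _ do rewrite ffunE act_sum mulr_sumr.
under [RHS]eq_bigr => u _ do rewrite ffunE mulr_suml.
rewrite [RHS]exchange_big /=; apply: eq_bigr => s _.
rewrite [RHS](reindex_inj (mulIg s)) /=; apply: eq_bigr => t _.
rewrite mulgK actM mulrA pact_comp; congr (_ * act s (act t (h _))).
by rewrite invMg mulgA.
Qed.
Lemma smash_mul1 : left_id smash_one smash_mul.
Proof.
move=> f; apply/ffunP => w; rewrite !ffunE (bigD1 1%g) //= big1 => [|s /negPf s1].
  by rewrite ffunE eqxx mul1r addr0 invg1 mulg1 pact_id.
by rewrite ffunE s1 mul0r.
Qed.
Lemma smash_1mul : right_id smash_one smash_mul.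
Proof.
move=> f; apply/ffunP => w; rewrite !ffunE (bigD1 w) //= big1 => [|s /negPf sw].
  by rewrite ffunE mulgV eqxx act1 mulr1 addr0.
by rewrite ffunE -eq_mulgV1 eq_sym sw act0 mulr0.
Qed.
Lemma smash_linl v : linear (smash_mul^~ v).
Proof.
move=> c f g; apply/ffunP => w; rewrite !ffunE scaler_sumr -big_split /=.
by apply: eq_bigr => s _; rewrite !ffunE mulrDl scalerAl.
Qed.
Lemma smash_linr v : linear (smash_mul v).
Proof.
move=> c f g; apply/ffunP => w; rewrite !ffunE scaler_sumr -big_split /=.
by apply: eq_bigr => s _; rewrite !ffunE actP mulrDr scalerAr.
Qed.

Definition smash : pzAlgebra F :=
  PzAlgebra (AlgStructure smash_mulA smash_mul1 smash_1mul
    smash_linl smash_linr).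

Definition smash_in (a : A) : smash := [ffun w => a *+ (w == 1%g)] : M.
Definition smash_perm (s : 'S_n) : smash := [ffun w => (w == s)%:R] : M.

Let mulE (f g : smash) : f * g = smash_mul f g.
Proof. by []. Qed.

Lemma smash_in_alg_hom : @alg_hom F (pz_of A) smash smash_in.
Proof.
split; last split.
- by move=> c a b; apply/ffunP => w; rewrite !ffunE mulrnDl scalerMnr.
- by [].
- move=> a b; rewrite mulE; apply/ffunP => w; rewrite !ffunE.
  rewrite (bigD1 1%g) //= big1 => [|s /negPf s1].
    by rewrite !ffunE eqxx addr0 invg1 mulg1 pact_id mulrnAr.
  by rewrite !ffunE s1 mul0r.
Qed.
Lemma smash_permM (s t : 'S_n) :
  smash_perm s * smash_perm t = smash_perm (t * s)%g.
Proof.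
rewrite mulE; apply/ffunP => w; rewrite !ffunE.
rewrite (bigD1 s) //= big1 => [|u /negPf us]; last by rewrite !ffunE us mul0r.
rewrite !ffunE eqxx addr0 mul1r (can2_eq (mulgKV s) (mulgK s)).
by case: eqP; rewrite ?act1 ?act0.
Qed.
Lemma smash_perm_in (s : 'S_n) (a : A) :
  smash_perm s * smash_in a = smash_in (act s a) * smash_perm s.
Proof.
rewrite !mulE; apply/ffunP => w; rewrite !ffunE.
rewrite (bigD1 s) //= big1 => [|u /negPf us]; last by rewrite !ffunE us mul0r.
rewrite [RHS](bigD1 1%g) //= [in RHS]big1 => [|u /negPf us]; last first.
  by rewrite !ffunE us mul0r.
rewrite !ffunE !eqxx !addr0 mul1r invg1 mulg1 pact_id -eq_mulgV1.
by case: eqP; rewrite ?mulr1 ?mulr0 ?mulr1n ?mulr0n ?act0.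
Qed.
End Smash.

(* The Laurent polynomial ring F[x_1^{+-1}, .., x_n^{+-1}], as the group
   algebra of the additive group Z^n of exponent vectors. *)
Definition laurent (F : fieldType) (n : nat) : Type :=
  {malg F[{ffun 'I_n -> int}]}.

Section Laurent.
Variables (F : fieldType) (n : nat).
Local Notation E := {ffun 'I_n -> int}.
Local Notation L := (laurent F n).

HB.instance Definition _ := GRing.Lmodule.on L.

Definition lmon (e : E) : L := << e >>.
Definition lmul (f g : L) : L :=
  mlin (fun d : E => mlin (fun e : E => lmon (d + e)) g) f.

Lemma lmulmm d e : lmul (lmon d) (lmon e) = lmon (d + e).
Proof. by rewrite /lmul !mlinU. Qed.
Lemma lmul_linl g : linear (lmul^~ g).
Proof. by move=> c f1 f2; rewrite /lmul linearP. Qed.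
Lemma lmul_linr f : linear (lmul f).
Proof.
move=> c g1 g2; rewrite /lmul /mlin scaler_sumr -big_split /=.
apply: eq_bigr => d _; rewrite -![in LHS]/(mlin _ _) linearP scalerDr.
by rewrite !scalerA mulrC.
Qed.

Lemma lmulC : commutative lmul.
Proof.
move=> f g; apply: (malg_ext (lmul_linl g) (lmul_linr g)) => d.
apply: (malg_ext (lmul_linr (lmon d)) (lmul_linl (lmon d))) => e.
by rewrite !lmulmm addrC.
Qed.
Lemma lmulA : associative lmul.
Proof.
move=> f g h.
apply: (malg_ext (f1 := fun f => lmul f (lmul g h))
  (f2 := fun f => lmul (lmul f g) h)) => [|c f1 f2|d].
- exact: lmul_linl.
- by rewrite !lmul_linl.
apply: (malg_ext (f1 := fun g => lmul (lmon d) (lmul g h))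
  (f2 := fun g => lmul (lmul (lmon d) g) h)) => [c g1 g2|c g1 g2|e].
- by rewrite lmul_linl lmul_linr.
- by rewrite lmul_linr lmul_linl.
apply: (malg_ext (f1 := fun h => lmul (lmon d) (lmul (lmon e) h))
  (f2 := fun h => lmul (lmul (lmon d) (lmon e)) h)) => [c h1 h2|c h1 h2|k].
- by rewrite !lmul_linr.
- by rewrite !lmul_linr.
by rewrite !lmulmm addrA.
Qed.
Lemma lmul1 : left_id (lmon 0) lmul.
Proof.
move=> f.
apply: (malg_ext (f1 := lmul (lmon 0)) (f2 := id)) => [|//|d].
  exact: lmul_linr.
by rewrite lmulmm add0r.
Qed.
Lemma lmulDl : left_distributive lmul +%R.
Proof. by move=> a b c; have := lmul_linl c 1 a b; rewrite !scale1r. Qed.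
Lemma lone_neq0 : lmon 0 != 0.
Proof. by rewrite /lmon monalgU_eq0 oner_eq0. Qed.

HB.instance Definition _ := GRing.Zmodule_isComNzRing.Build L
  lmulA lmulC lmul1 lmulDl lone_neq0.

Lemma laurent_scalerAl (c : F) (f g : L) : c *: (f * g) = (c *: f) * g.
Proof.
by rewrite -[in RHS](addr0 (c *: f)) /GRing.mul /= lmul_linl -[lmul 0 g]/(0 * g) mul0r addr0.
Qed.
HB.instance Definition _ := GRing.Lmodule_isLalgebra.Build F L laurent_scalerAl.
HB.instance Definition _ := GRing.Lalgebra_isComAlgebra.Build F L.

Lemma lmonD d e : lmon (d + e) = lmon d * lmon e.
Proof. by rewrite /GRing.mul /= lmulmm. Qed.

Definition expo1 (i : 'I_n) : E := [ffun j => (j == i)%:R].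
Definition lX (i : 'I_n) : L := lmon (expo1 i).
Definition lXV (i : 'I_n) : L := lmon (- expo1 i).

Lemma lX_lXV i : lX i * lXV i = 1.
Proof. by rewrite -lmonD subrr. Qed.

Definition lsym (s : 'S_n) : L -> L :=
  mlin (fun e : E => lmon [ffun i => e ((s^-1)%g i)]).

Lemma lsym_mon s e : lsym s (lmon e) = lmon [ffun i => e ((s^-1)%g i)].
Proof. by rewrite /lsym mlinU. Qed.
Lemma lsym_linear s : linear (lsym s).
Proof. exact: mlin_linear. Qed.
Lemma lsym_lX s i : lsym s (lX i) = lX (s i).
Proof.
rewrite lsym_mon; congr lmon; apply/ffunP => j; rewrite !ffunE.
by rewrite (can2_eq (permKV s) (permK s)).
Qed.

Definition laurent_alg : algType F := GRing.Algebra.clone F L _.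

Lemma lsym_alg_hom s :
  @alg_hom F (pz_of laurent_alg) (pz_of laurent_alg) (lsym s).
Proof.
split; first exact: lsym_linear.
split; first by rewrite [LHS]lsym_mon; congr lmon; apply/ffunP => i; rewrite !ffunE.
move=> f g.
apply: (malg_ext (f1 := fun f : L => lsym s (f * g))
  (f2 := fun f : L => lsym s f * lsym s g)) => [c f1 f2|c f1 f2|d].
- by rewrite mulrDl -scalerAl lsym_linear.
- by rewrite lsym_linear mulrDl -scalerAl.
apply: (malg_ext (f1 := fun g : L => lsym s (lmon d * g))
  (f2 := fun g : L => lsym s (lmon d) * lsym s g)) => [c f1 f2|c f1 f2|e].
- by rewrite mulrDr -scalerAr lsym_linear.
- by rewrite lsym_linear mulrDr -scalerAr.
rewrite -lmonD !lsym_mon -lmonD; congr lmon.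
by apply/ffunP => i; rewrite !ffunE.
Qed.
Lemma lsym_id f : lsym 1%g f = f.
Proof.
apply: (malg_ext (f2 := id)) => [|//|e]; first exact: lsym_linear.
by rewrite lsym_mon; congr lmon; apply/ffunP => i; rewrite ffunE invg1 perm1.
Qed.
Lemma lsym_comp s t f : lsym (t * s)%g f = lsym s (lsym t f).
Proof.
apply: (malg_ext (f2 := fun f => lsym s (lsym t f))) => [|c f1 f2|e].
- exact: lsym_linear.
- by rewrite !lsym_linear.
rewrite !lsym_mon; congr lmon; apply/ffunP => i.
by rewrite !ffunE invMg permM.
Qed.

Definition laurent_action : perm_action n laurent_alg :=
  PermAction lsym_alg_hom lsym_id lsym_comp.

Definition laurent_of_poly (p : mpoly n F) : L := mpoly.mmap (in_alg L) lX p.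
End Laurent.

Section PolyAction.
Variables (F : fieldType) (n : nat).
Local Notation P := (mpoly n F).

Definition poly_alg : algType F := GRing.Algebra.clone F P _.

Lemma msym_alg_hom (s : 'S_n) :
  @alg_hom F (pz_of poly_alg) (pz_of poly_alg) (msym s).
Proof.
split; first by move=> c p q; rewrite [LHS]raddfD /= msymZ.
by split; [exact: msym1 | exact: msymM].
Qed.
Lemma msym_id (p : P) : msym 1%g p = p.
Proof.
apply/mpolyP => m; rewrite mcoeff_sym; congr (_ @_ _).
by apply/mnmP => i; rewrite mnmE perm1.
Qed.
Lemma msym_comp (s t : 'S_n) (p : P) : msym (t * s)%g p = msym s (msym t p).
Proof.
apply/mpolyP => m; rewrite !mcoeff_sym; congr (_ @_ _).
by apply/mnmP => i; rewrite !mnmE permM.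
Qed.

Definition poly_action : perm_action n poly_alg :=
  PermAction msym_alg_hom msym_id msym_comp.

Lemma msym_mpolyX (s : 'S_n) (i : 'I_n) : msym s 'X_i = 'X_(s i) :> P.
Proof. by rewrite /msym mmapX mmap1U. Qed.
End PolyAction.

(* The tensor product L (x)_P H over a ring P acting through a : P -> L and
   b : P -> H. *)
Section Tensor.
Variables (F : fieldType) (P : Type) (L H : pzAlgebra F).
Variables (a : P -> L) (b : P -> H).

Inductive tensor_relator : {malg F[(L * H)%type]} -> Prop :=
| tr_addl f f' h :
    tensor_relator (<< (f + f', h) >> - (<< (f, h) >> + << (f', h) >>))
| tr_addr f h h' :
    tensor_relator (<< (f, h + h') >> - (<< (f, h) >> + << (f, h') >>))
| tr_scale (c : F) f h :
    tensor_relator (<< (c *: f, h) >> - c *: << (f, h) >>)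
| tr_balanced f p h :
    tensor_relator (<< (f * a p, h) >> - << (f, b p * h) >>).

Definition tensor : lmodType F := lquot (span_of tensor_relator).
Definition tens (f : L) (h : H) : tensor :=
  qpi (span_of tensor_relator) << (f, h) >>.
End Tensor.

Section Cherednik.
Variables (F : fieldType) (n : nat) (kappa : F).

Local Notation transp i j := (tperm (i : 'I_n) (j : 'I_n)).

(* Indices run over 'I_n = {0, .., n-1}; a simple transposition is
   s_i = tperm i i' with i' = i + 1. *)
Section Rational.
Definition rat_smash : pzAlgebra F := smash (poly_action F n).
Definition rat_free : pzAlgebra F := free_prod rat_smash (pz_of (poly_alg F n)).
Definition rat_poly (p : poly_alg F n) : rat_free :=
  fp_inl _ (smash_in (poly_action F n) p : rat_smash).
Definition rat_s (w : 'S_n) : rat_free :=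
  fp_inl _ (smash_perm (poly_action F n) w : rat_smash).
Definition rat_ypoly (p : poly_alg F n) : rat_free :=
  fp_inr (B := pz_of (poly_alg F n)) rat_smash p.

Local Notation s := rat_s.
Local Notation x i := (rat_poly 'X_i).
Local Notation y i := (rat_ypoly 'X_i).

Inductive rca_rel : rat_free -> rat_free -> Prop :=
| rca_sy (i i' j : 'I_n) : i' = i.+1 :> nat ->
    rca_rel (s (transp i i') * y j) (y (transp i i' j) * s (transp i i'))
| rca_yx (i : 'I_n) :
    rca_rel (commutator (y i) (x i))
      (kappa *: (1 : rat_free) + \sum_(k : 'I_n | k != i) s (transp i k))
| rca_yx' (i j : 'I_n) : i != j ->
    rca_rel (commutator (y i) (x j)) (- s (transp i j)).

(* rca is the rational Cherednik algebra. *)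
Definition rca : pzAlgebra F := quot_by rca_rel.
Definition rca_pi : rat_free -> rca := quot_pi rca_rel.
Definition rca_poly (p : poly_alg F n) : rca := rca_pi (rat_poly p).
Definition rca_s (w : 'S_n) : rca := rca_pi (s w).
Definition rca_x (i : 'I_n) : rca := rca_pi (x i).
Definition rca_y (i : 'I_n) : rca := rca_pi (y i).

Lemma rca_pi_alg_hom : alg_hom rca_pi.
Proof. exact: quot_pi_alg_hom. Qed.
Lemma rca_pi_rel a b : rca_rel a b -> rca_pi a = rca_pi b.
Proof. exact: quot_pi_rel. Qed.
End Rational.

Section Trigonometric.
Definition trig_smash : pzAlgebra F := smash (laurent_action F n).
Definition trig_free : pzAlgebra F :=
  free_prod trig_smash (pz_of (poly_alg F n)).
Definition trig_laurent (f : laurent_alg F n) : trig_free :=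
  fp_inl _ (smash_in (laurent_action F n) f : trig_smash).
Definition trig_s (w : 'S_n) : trig_free :=
  fp_inl _ (smash_perm (laurent_action F n) w : trig_smash).
Definition trig_upoly (p : poly_alg F n) : trig_free :=
  fp_inr (B := pz_of (poly_alg F n)) trig_smash p.

Local Notation s := trig_s.
Local Notation x i := (trig_laurent (lX F i)).
Local Notation u i := (trig_upoly 'X_i).

Inductive ddaha_rel : trig_free -> trig_free -> Prop :=
| ddaha_su (i i' : 'I_n) : i' = i.+1 :> nat ->
    ddaha_rel (s (transp i i') * u i) (u i' * s (transp i i') - 1)
| ddaha_su' (i i' : 'I_n) : i' = i.+1 :> nat ->
    ddaha_rel (s (transp i i') * u i') (u i * s (transp i i') + 1)
| ddaha_suj (i i' j : 'I_n) : i' = i.+1 :> nat -> j != i -> j != i' ->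
    ddaha_rel (s (transp i i') * u j) (u j * s (transp i i'))
| ddaha_ux (i : 'I_n) :
    ddaha_rel (commutator (u i) (x i))
      (kappa *: x i + \sum_(k : 'I_n | (k < i)%N) x k * s (transp k i)
                    + \sum_(k : 'I_n | (i < k)%N) x i * s (transp i k))
| ddaha_ux_gt (i j : 'I_n) : (j < i)%N ->
    ddaha_rel (commutator (u i) (x j)) (- (x j * s (transp j i)))
| ddaha_ux_lt (i j : 'I_n) : (i < j)%N ->
    ddaha_rel (commutator (u i) (x j)) (- (x i * s (transp i j))).

(* ddaha is the degenerate double affine Hecke algebra of type GL_n. *)
Definition ddaha : pzAlgebra F := quot_by ddaha_rel.
Definition ddaha_pi : trig_free -> ddaha := quot_pi ddaha_rel.
Definition ddaha_s (w : 'S_n) : ddaha := ddaha_pi (s w).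
Definition ddaha_x (i : 'I_n) : ddaha := ddaha_pi (x i).
Definition ddaha_xV (i : 'I_n) : ddaha := ddaha_pi (trig_laurent (lXV F i)).
Definition ddaha_u (i : 'I_n) : ddaha := ddaha_pi (u i).

Lemma ddaha_pi_alg_hom : alg_hom ddaha_pi.
Proof. exact: quot_pi_alg_hom. Qed.
Lemma ddaha_pi_rel a b : ddaha_rel a b -> ddaha_pi a = ddaha_pi b.
Proof. exact: quot_pi_rel. Qed.
End Trigonometric.

Definition loc_mod : lmodType F :=
  tensor (L := pz_of (laurent_alg F n)) (@laurent_of_poly F n) rca_poly.
Definition loc_tens (f : laurent_alg F n) (h : rca) : loc_mod :=
  tens (L := pz_of (laurent_alg F n)) (@laurent_of_poly F n) rca_poly f h.

(* The tensor product loc_mod is only a vector space; these conditions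
   determine its algebra structure. *)
Record is_localization (S : alg_structure loc_mod) : Prop := IsLocalization {
  loc_laurent_hom :
    @alg_hom F (pz_of (laurent_alg F n)) (PzAlgebra S) (fun f => loc_tens f 1);
  loc_rca_hom :
    @alg_hom F rca (PzAlgebra S) (fun h => loc_tens 1 h);
  loc_mulE : forall (f : laurent_alg F n) (h : rca),
    (loc_tens f 1 : PzAlgebra S) * loc_tens 1 h = loc_tens f h
}.

Definition iota_spec (iota : rca -> ddaha) : Prop :=
  [/\ forall w : 'S_n, iota (rca_s w) = ddaha_s w,
      forall i : 'I_n, iota (rca_x i) = ddaha_x i
    & forall i : 'I_n, iota (rca_y i) =
        ddaha_xV i *
          (ddaha_u i - \sum_(j : 'I_n | (j < i)%N) ddaha_s (transp j i))].

(* Elements of H_kappa and of F[x^{+-1}] are viewed in the localization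
   through h |-> 1 (x) h and f |-> f (x) 1. *)
Definition jmath_spec (S : alg_structure loc_mod)
    (jmath : ddaha -> PzAlgebra S) : Prop :=
  [/\ forall w : 'S_n, jmath (ddaha_s w) = loc_tens 1 (rca_s w),
      forall i : 'I_n, jmath (ddaha_x i) = loc_tens (lX F i) 1
    & forall i : 'I_n, jmath (ddaha_u i) =
        (loc_tens (lX F i) 1 : PzAlgebra S) * loc_tens 1 (rca_y i)
        + \sum_(j : 'I_n | (j < i)%N)
            (loc_tens 1 (rca_s (transp j i)) : PzAlgebra S)].
End Cherednik.

(* Main.v *)
From HB Require Import structures.
From mathcomp Require Import fingroup perm.
From mathcomp Require Import all_boot all_order all_algebra.
From mathcomp Require Import finmap boolp.
From mathcomp Require Import monalg ssrcomplements mpoly.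
From mathcomp Require Import zify.
Require Import Defs.

Set Implicit Arguments.
Unset Strict Implicit.
Unset Printing Implicit Defensive.

Import GRing.Theory.
Local Open Scope ring_scope.

(** The map iota exists because the defining relations of the two algebras are
    equivalent as soon as the x_i are invertible.  In any algebra containing
    F[x^{+-1}] x| S_n, let phi_i be the sum of the s_ji over j < i (a
    Jucys--Murphy element) and substitute u_i = x_i y_i + phi_i.  The phi_i
    satisfy the inhomogeneous relations of the u_i with the simple reflections
    ([murphy_simple]), so those relations for u become the S_n-equivariance of
    z_i = x_i y_i; subtracting [phi_i, x_j] from [u_i, x_j] makes the latter
    symmetric in the indices and gives [y_i, x_j]; finally
    [u_i, u_j] = x_i x_j [y_i, y_j] for i < j ([commutator_trig]), so that the
    u_i commute if and only if the y_i do.  Each direction is used once: from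
    u to y to define iota, from y to u to make the trigonometric algebra act on
    a module below.

    Injectivity of iota is a Poincare--Birkhoff--Witt argument.  The monomials
    x^a y^b w span the rational algebra, because [y_i, f(x)] lies in
    F[x] x| S_n ([triangular_span]).  Let M be the space
    F[x^{+-1}] (x) (F[y] x| S_n), on which x acts by multiplication, w
    diagonally, and y_i by the Dunkl operator

      f (x) b |-> kappa d_i f (x) b + f (x) y_i b
                  + sum_(k != i) ((f - s_ik f) / (x_i - x_k)) (x) s_ik b.

    By the Jacobi identity [y_i, y_j] commutes with all the x_k
    ([commYY_X]), and it kills 1 (x) b, hence it vanishes; so M is a module
    over the trigonometric algebra ([exists_rep]).  Acting through iota, x^a y^b w sends
    1 (x) 1 to x^a (x) y^b w.  The spanning monomials are thus linearly
    independent already after applying iota ([iota_injective]).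

    For the second part, f (x) h |-> f iota(h) is a linear map Phi from the
    tensor product to the trigonometric algebra.  Its image is a left ideal
    containing 1.  It is injective because every tensor has the form
    x^{-m} (x) h, and x^m and iota are injective.  Transporting the product
    along Phi gives the localization.  Conversely, for any product with the
    required properties Phi is multiplicative: the elements b such that
    Phi(ab) = Phi(a) Phi(b) for all a form a subalgebra, which contains H and
    is closed under inverting the x_i ([localization_hom]).  The inverse of
    Phi is then the map jmath. *)

(** * Linear maps, subspaces and algebra homomorphisms *)

Section LinearFacts.
Variables (F : fieldType) (V W : lmodType F) (f : V -> W).
Hypothesis lf : linear f.

Definition linear_pack : {linear V -> W} :=
  HB.pack_for {linear V -> W} f (GRing.isLinear.Build F V W *:%R f lf).

Lemma lin0 : f 0 = 0. Proof. exact: (linear0 linear_pack). Qed.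
Lemma linD : {morph f : x y / x + y}. Proof. exact: (linearD linear_pack). Qed.
Lemma linN : {morph f : x / - x}. Proof. exact: (linearN linear_pack). Qed.
Lemma linB : {morph f : x y / x - y}. Proof. exact: (linearB linear_pack). Qed.
Lemma linZ c : {morph f : x / c *: x}. Proof. exact: (linearZZ linear_pack). Qed.
Lemma lin_sum (I : Type) (r : seq I) (P : pred I) (E : I -> V) :
  f (\sum_(i <- r | P i) E i) = \sum_(i <- r | P i) f (E i).
Proof. exact: (linear_sum linear_pack). Qed.
End LinearFacts.

Section Submodules.
Variables (F : fieldType).

Lemma sub_mem_sum (V : lmodType F) (W : submodule V) (I : Type) (r : seq I)
    (P : pred I) (E : I -> V) :
  (forall i, P i -> W (E i)) -> W (\sum_(i <- r | P i) E i).
Proof.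
move=> WE; elim/big_rec: _ => [|i x Pi Wx]; first exact: sub_mem0.
by apply: sub_memD => //; apply: WE.
Qed.

Lemma in_spanP (V : lmodType F) (S : V -> Prop) (W : submodule V) v :
  (forall u, S u -> W u) -> span_of S v -> W v.
Proof.
move=> SW; elim=> {v} [v|| c u v _ Wu _ Wv]; first exact: SW.
  exact: sub_mem0.
exact: sub_memZD.
Qed.

Lemma preim_sub0 (V V' : lmodType F) (f : V -> V') (lf : linear f)
  (W : submodule V') : W (f 0).
Proof. by rewrite (lin0 lf); apply: sub_mem0. Qed.
Lemma preim_subZD (V V' : lmodType F) (f : V -> V') (lf : linear f)
  (W : submodule V') c u v : W (f u) -> W (f v) -> W (f (c *: u + v)).
Proof. by rewrite lf; apply: sub_memZD. Qed.
Definition preim_sub (V V' : lmodType F) (f : V -> V') (lf : linear f)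
    (W : submodule V') : submodule V :=
  Submodule (preim_sub0 lf W) (@preim_subZD _ _ _ lf W).

Lemma eq_sub0 (V V' : lmodType F) (f g : V -> V') (lf : linear f)
  (lg : linear g) : f 0 = g 0.
Proof. by rewrite (lin0 lf) (lin0 lg). Qed.
Lemma eq_subZD (V V' : lmodType F) (f g : V -> V') (lf : linear f)
  (lg : linear g) c u v : f u = g u -> f v = g v ->
  f (c *: u + v) = g (c *: u + v).
Proof. by rewrite lf lg => -> ->. Qed.
Definition eq_sub (V V' : lmodType F) (f g : V -> V') (lf : linear f)
    (lg : linear g) : submodule V :=
  Submodule (eq_sub0 lf lg) (@eq_subZD _ _ _ _ lf lg).

Lemma range_sub0 (V V' : lmodType F) (f : V -> V') (lf : linear f) :
  exists u, f u = 0.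
Proof. by exists 0; apply: lin0. Qed.
Lemma range_subZD (V V' : lmodType F) (f : V -> V') (lf : linear f) c u v :
  (exists x, f x = u) -> (exists y, f y = v) -> exists z, f z = c *: u + v.
Proof. by move=> [x <-] [y <-]; exists (c *: x + y); rewrite lf. Qed.
Definition range_sub (V V' : lmodType F) (f : V -> V') (lf : linear f) :
    submodule V' := Submodule (range_sub0 lf) (range_subZD lf).

Variable (A : pzAlgebra F).

Lemma linear_mull (a : A) : linear (fun b : A => a * b).
Proof. exact: (as_linr (alg_str A) a). Qed.
Lemma linear_mulr (a : A) : linear (fun b : A => b * a).
Proof. exact: (as_linl (alg_str A) a). Qed.

Lemma lstab0 (W : submodule A) (b : A) : W b -> W (0 * b).
Proof. by rewrite mul0r => _; apply: sub_mem0. Qed.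
Lemma lstabZD (W : submodule A) c (u v : A) :
  (forall b : A, W b -> W (u * b)) -> (forall b : A, W b -> W (v * b)) ->
  forall b : A, W b -> W ((c *: u + v) * b).
Proof.
move=> Wu Wv b Wb; rewrite mulrDl -pzscalerAl.
exact: (sub_memZD c (Wu b Wb) (Wv b Wb)).
Qed.
(** The left multipliers of W; they are closed under products as well, which
    is how generators of an algebra are traded for other generators. *)
Definition lstab (W : submodule A) : submodule A :=
  Submodule (V := A) (lstab0 (W := W)) (lstabZD (W := W)).
End Submodules.

Section AlgHomFacts.
Variables (F : fieldType).

Lemma alg_hom_comp (A B C : pzAlgebra F) (f : A -> B) (g : B -> C) :
  alg_hom f -> alg_hom g -> alg_hom (g \o f).
Proof.
move=> [lf [f1 fM]] [lg [g1 gM]]; split.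
  by move=> c a b; rewrite /= lf lg.
by split=> [|a b]; rewrite /= ?f1 ?g1 ?fM ?gM.
Qed.

Lemma alg_homM_com (A : algType F) (B : pzAlgebra F) (f : A -> B) (a b : A) :
  @alg_hom F (pz_of A) B f -> a * b = b * a -> f a * f b = f b * f a.
Proof. by move=> [_ [_ fM]] ab; rewrite -[LHS]fM -[RHS]fM; congr f. Qed.

Lemma alg_homM_inv (A : algType F) (B : pzAlgebra F) (f : A -> B) (a b : A) :
  @alg_hom F (pz_of A) B f -> a * b = 1 -> f a * f b = 1.
Proof. by move=> [_ [f1 fM]] ab; rewrite -[LHS]fM -f1; congr f. Qed.

Lemma alg_homB_comm (A B : pzAlgebra F) (f : A -> B) (a b : A) : alg_hom f ->
  f (commutator a b) = commutator (f a) (f b).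
Proof. by move=> [lf [_ fM]]; rewrite /commutator (linB lf) !fM. Qed.

(** The images are parameters, so that the value of f on a product of named
    elements is found without rewriting inside the domain, where the names
    unfold to classes of a quotient. *)
Lemma alg_homME (A B : pzAlgebra F) (f : A -> B) (a b : A) (a' b' : B) :
  alg_hom f -> f a = a' -> f b = b' -> f (a * b) = a' * b'.
Proof. by move=> [_ [_ fM]] <- <-; apply: fM. Qed.

Lemma alg_hom_commE (A B : pzAlgebra F) (f : A -> B) (a b : A) (a' b' : B) :
  alg_hom f -> f a = a' -> f b = b' -> f (commutator a b) = commutator a' b'.
Proof. by move=> homf <- <-; apply: alg_homB_comm. Qed.

(** Generation of A as an algebra, phrased as an induction principle: a
    subspace that contains 1 and is stable under left multiplication by the
    elements of G is everything. *)
Definition generates (A : pzAlgebra F) (G : A -> Prop) : Prop :=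
  forall W : submodule A, W 1 -> (forall g a : A, G g -> W a -> W (g * a)) ->
  forall a, W a.

Lemma generates_lstab (A B : pzAlgebra F) (f : A -> B) (G : A -> Prop)
    (W : submodule B) : alg_hom f -> generates G ->
  (forall g, G g -> lstab W (f g)) -> forall a, lstab W (f a).
Proof.
move=> [lf [f1 fM]] genG WG.
apply: (genG (preim_sub lf (lstab W))) => /= [b|g a Gg Wa b Wb].
  by rewrite f1 mul1r.
by rewrite fM -mulrA; apply: WG => //; apply: Wa.
Qed.

Lemma generates_sub (A : pzAlgebra F) (G G' : A -> Prop) :
  generates G -> (forall (W : submodule A) g, (forall g', G' g' -> lstab W g') ->
     G g -> lstab W g) -> generates G'.
Proof.
move=> genG GG' W W1 WG'; apply: genG => // g a Gg Wa.
by apply: (GG' W g) => // g' G'g' b Wb; apply: WG'.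
Qed.

Lemma alg_hom_ext (A B : pzAlgebra F) (f g : A -> B) (G : A -> Prop) :
  generates G -> alg_hom f -> alg_hom g -> (forall a, G a -> f a = g a) ->
  f =1 g.
Proof.
move=> genG [lf [f1 fM]] [lg [g1 gM]] fg.
apply: (genG (eq_sub lf lg)) => /= [|x a Gx fga]; first by rewrite f1 g1.
by rewrite fM gM fg // fga.
Qed.

(** * Universal properties and generators of the constructions *)

Section Quot.
Variables (A : pzAlgebra F) (R : A -> A -> Prop).

Lemma generates_quot (G : A -> Prop) : generates G ->
  generates (fun q : quot_by R => exists2 a, G a & q = quot_pi R a).
Proof.
move=> genG W W1 WG; apply: quot_pi_ind.
have [lp [p1 pM]] := quot_pi_alg_hom R.
apply: (genG (preim_sub lp W)) => /= [|g a Gg Wa]; first by rewrite p1.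
by rewrite pM; apply: WG => //; exists g.
Qed.

Lemma quot_lift (B : pzAlgebra F) (f : A -> B) : alg_hom f ->
  (forall a b, R a b -> f a = f b) ->
  exists f' : quot_by R -> B, alg_hom f' /\ forall a, f' (quot_pi R a) = f a.
Proof.
move=> [lf [f1 fM]] fR.
have ex q : exists a, quot_pi R a = q by elim/quot_pi_ind: q => a; exists a.
pose rep q := projT1 (cid (ex q)).
have repK q : quot_pi R (rep q) = q := projT2 (cid (ex q)).
(* f vanishes on the ideal generated by the relators *)
have fE a b : quot_pi R a = quot_pi R b -> f a = f b.
  move=> /quot_piP ab; apply/eqP; rewrite -subr_eq0 -(linB lf); apply/eqP.
  elim: ab => {a b} [_ [a [b [Rab ->]]]||a b _ fa _ fb|a b c _ fb].
  - by rewrite (linB lf) (fR _ _ Rab) subrr.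
  - exact: lin0.
  - by rewrite (linD lf) fa fb addr0.
  - by rewrite !fM fb mulr0 mul0r.
have [lp [p1 pM]] := quot_pi_alg_hom R.
exists (f \o rep); split=> [|a /=]; last exact/fE/repK.
split; last split=> /=.
- by move=> c p q /=; rewrite -lf; apply: fE; rewrite lp !repK.
- by rewrite -f1; apply: fE; rewrite p1 repK.
- by move=> p q /=; rewrite -fM; apply: fE; rewrite pM !repK.
Qed.
End Quot.

Section Free.
Variables (X : choiceType).

Lemma free_mulmm (k l : {fmonom X}) :
  (<< k >> : free_alg F X) * << l >> = << mmul k l >>.
Proof. by rewrite -[LHS]/(monalg.fgmul _ _) fgmulUU mulr1. Qed.

Lemma fmonom_ind (P : {fmonom X} -> Prop) :
  P mone -> (forall x k, P k -> P (mmul (fmu x) k)) -> forall k, P k.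
Proof.
move=> P1 PM k.
suff Pk s : P (fmonom_of_seq fmonom_key s) by case: k => s; rewrite -fmE.
elim: s => [//|x s IHs].
by have := PM x _ IHs; rewrite /mmul /= /fmmul /fmu !fmE.
Qed.

Lemma generates_free :
  generates (fun a : free_alg F X => exists x, a = free_gen F x).
Proof.
move=> W W1 WG a; rewrite [a]monalgE; apply: sub_mem_sum => k _.
rewrite mkmalgU_scale; apply: sub_memZ.
elim/fmonom_ind: k => [//|x k Wk].
have := WG (free_gen F x) _ (ex_intro _ x erefl) Wk.
by rewrite free_mulmm.
Qed.

Lemma free_lift (B : pzAlgebra F) (f : X -> B) :
  exists f' : free_alg F X -> B, alg_hom f' /\ forall x, f' (free_gen F x) = f x.
Proof.
pose h (k : {fmonom X}) : B := \prod_(x <- fmonom_val k) f x.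
have h1 : h mone = 1 by rewrite /h /= /mone /= /fmone fmE big_nil.
have hM k l : h (mmul k l) = h k * h l.
  by rewrite /h /mmul /= /fmmul fmE /= big_cat.
pose f' : free_alg F X -> B := mlin h.
have lf : linear f' by exact: mlin_linear.
exists f'; split; last first.
  by move=> x; rewrite /f' mlinU /h /fmu fmE big_seq1.
split=> //; split; first by rewrite /f' /= [mlin h _]mlinU.
move=> a b /=.
apply: (malg_ext (f1 := fun a : free_alg F X => f' (a * b))
          (f2 := fun a : free_alg F X => f' a * f' b)) => [c u v|c u v|k].
- by rewrite linear_mulr lf.
- by rewrite lf linear_mulr.
apply: (malg_ext (f1 := fun b : free_alg F X => f' ((<< k >> : free_alg F X) * b))
          (f2 := fun b : free_alg F X => f' << k >> * f' b)) => [c u v|c u v|l].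
- by rewrite linear_mull lf.
- by rewrite lf linear_mull.
by rewrite free_mulmm /f' !mlinU hM.
Qed.
End Free.

Section FreeProd.
Variables (A B : pzAlgebra F).

Lemma generates_free_prod (G : A -> Prop) (H : B -> Prop) :
  generates G -> generates H ->
  generates (fun q : free_prod A B => (exists2 a, G a & q = fp_inl B a) \/
                            (exists2 b, H b & q = fp_inr A b)).
Proof.
move=> genG genH.
apply: (generates_sub (generates_quot (generates_free (X := (A + B)%type)))).
move=> W _ WG [_ [[a|b] ->] ->].
  apply: (generates_lstab (fp_inl_alg_hom A B) genG) => g Gg.
  by apply: WG; left; exists g.
apply: (generates_lstab (fp_inr_alg_hom A B) genH) => g Gg.
by apply: WG; right; exists g.
Qed.

Lemma free_prod_lift (C : pzAlgebra F) (f : A -> C) (g : B -> C) :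
  alg_hom f -> alg_hom g ->
  exists h : free_prod A B -> C,
    [/\ alg_hom h, forall a, h (fp_inl B a) = f a
      & forall b, h (fp_inr A b) = g b].
Proof.
move=> [lf [f1 fM]] [lg [g1 gM]].
pose fg (x : (A + B)%type) := match x with inl a => f a | inr b => g b end.
have [h0 [hom0 h0E]] := free_lift fg; have [l0 [h01 h0M]] := hom0.
have [|h [homh hE]] := @quot_lift _ (@free_prod_rel F A B) C h0 hom0.
  have h0f a : h0 (free_gen F (inl a)) = f a by rewrite h0E.
  have h0g b : h0 (free_gen F (inr b)) = g b by rewrite h0E.
  move=> _ _ [c a a'|a a'||c b b'|b b'|].
  - by rewrite l0 !h0f; apply: lf.
  - by rewrite h0M !h0f; apply: fM.
  - by rewrite h01 h0f; apply: f1.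
  - by rewrite l0 !h0g; apply: lg.
  - by rewrite h0M !h0g; apply: gM.
  - by rewrite h01 h0g; apply: g1.
exists h; split=> // [a|b]; rewrite /fp_inl /fp_inr hE h0E //.
Qed.
End FreeProd.

Section SmashLift.
Variables (n : nat) (A : algType F) (act : perm_action n A).
Local Notation sin := (smash_in act).
Local Notation sp := (smash_perm act).

Lemma smash_perm1 : sp 1%g = 1.
Proof. by apply/ffunP => w; rewrite !ffunE. Qed.

Lemma smashE (f : smash act) : f = \sum_(w : 'S_n) sin (f w) * sp w.
Proof.
suff term (a : A) w : sin a * sp w = [ffun t => a *+ (t == w)] :> {ffun _ -> _}.
  apply/ffunP => t; rewrite sum_ffunE (bigD1 t) //= term ffunE eqxx big1 ?addr0 //.
  by move=> w /negPf wt; rewrite term ffunE eq_sym wt.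
rewrite /GRing.mul /=; apply/ffunP => t; rewrite !ffunE.
rewrite (bigD1 1%g) //= big1 => [|s /negPf s1]; last by rewrite !ffunE s1 mul0r.
rewrite !ffunE eqxx addr0 invg1 mulg1 pact_id.
by case: eqP => _; rewrite ?mulr1 ?mulr0.
Qed.

Lemma generates_smash (G : pz_of A -> Prop) : generates G ->
  generates (fun q : smash act => (exists2 a, G a & q = sin a) \/
                                  (exists w, q = sp w)).
Proof.
move=> genG W W1 WG q; rewrite (smashE q); apply: sub_mem_sum => w _.
have WA : forall a, lstab W (sin a).
  apply: (generates_lstab (smash_in_alg_hom act) genG) => g Gg b Wb.
  by apply: WG => //; left; exists g.
by apply: WA; rewrite -[sp w]mulr1; apply: WG => //; right; exists w.
Qed.

Lemma smash_lift (B : pzAlgebra F) (f : A -> B) (s : 'S_n -> B) :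
  @alg_hom F (pz_of A) B f -> s 1%g = 1 ->
  (forall u v, s u * s v = s (v * u)%g) ->
  (forall u a, s u * f a = f (act u a) * s u) ->
  exists h : smash act -> B,
    [/\ alg_hom h, forall a, h (sin a) = f a & forall w, h (sp w) = s w].
Proof.
move=> [lf [f1 fM]] s1 sM sf.
pose h (q : smash act) : B := \sum_(w : 'S_n) f (q w) * s w.
have f0 : f 0 = 0 := lin0 lf.
have lh : linear h.
  move=> c u v; rewrite /h scaler_sumr -big_split /=; apply: eq_bigr => w _.
  by rewrite !ffunE lf mulrDl -pzscalerAl.
have hin a : h (sin a) = f a.
  rewrite /h (bigD1 1%g) //= big1 => [|w /negPf w1]; last first.
    by rewrite ffunE w1 f0 mul0r.
  by rewrite ffunE eqxx s1 mulr1 addr0.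
have hsp w : h (sp w) = s w.
  rewrite /h (bigD1 w) //= big1 => [|u /negPf u1]; last first.
    by rewrite ffunE u1 f0 mul0r.
  by rewrite ffunE eqxx f1 mul1r addr0.
exists h; split=> //; split=> //; split.
  by rewrite -s1 -hsp smash_perm1.
have hmul a w : h (sin a * sp w) = f a * s w.
  rewrite /h (bigD1 w) //= big1 => [|t tw]; rewrite /GRing.mul /= ffunE.
    rewrite (bigD1 1%g) //= big1 => [|u /negPf u1].
      by rewrite !ffunE eqxx !addr0 invg1 mulg1 pact_id eqxx mulr1.
    by rewrite ffunE u1 mul0r.
  rewrite big1 ?f0 -?[as_mul _ 0 _]/(0 * s t) ?mul0r // => u _.
  rewrite !ffunE; case: (u =P 1%g) => [->|_]; last by rewrite mul0r.
  by rewrite invg1 mulg1 pact_id (negPf tw) mulr0.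
move=> p q; rewrite (smashE p) (smashE q) mulr_suml !(lin_sum lh) mulr_suml.
apply: eq_bigr => u _; rewrite mulr_sumr (lin_sum lh) mulr_sumr.
apply: eq_bigr => v _; rewrite !hmul.
rewrite -mulrA [sp u * _]mulrA smash_perm_in -mulrA smash_permM mulrA.
have [_ [_ inM]] := smash_in_alg_hom act.
rewrite -(inM (p u : pz_of A) (act u (q v) : pz_of A)) hmul (fM (p u)).
by rewrite -!mulrA -sM [s u * (_ * _)]mulrA sf -!mulrA.
Qed.
End SmashLift.

End AlgHomFacts.

Section PolyLift.
Variables (F : fieldType) (n : nat).

Lemma mpoly_linear_ext (V : lmodType F) (f g : mpoly n F -> V) :
  linear f -> linear g -> (forall m, f 'X_[m] = g 'X_[m]) -> f =1 g.
Proof.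
move=> lf lg fg p; rewrite [p]mpolyE (lin_sum lf) (lin_sum lg).
by apply: eq_bigr => m _; rewrite (linZ lf) (linZ lg) fg.
Qed.

Lemma mpoly_span (W : submodule (mpoly n F)) : (forall m, W 'X_[m]) -> forall p, W p.
Proof.
by move=> WX p; rewrite [p]mpolyE; apply: sub_mem_sum => m _; apply: sub_memZ.
Qed.

Lemma generates_poly :
  generates (fun p : pz_of (poly_alg F n) => exists i, p = 'X_i).
Proof.
move=> W W1 WX; apply: mpoly_span => m; rewrite mpolyXE_id.
elim/big_rec: _ => [//|i p _ Wp].
elim: (m i) => [|k IHk]; first by rewrite expr0 mul1r.
by rewrite exprS -mulrA; apply: (WX 'X_i) => //; exists i.
Qed.

(** The target need not be commutative: only the images of the variables
    commute, so the image of a monomial is an ordered product. *)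
Lemma poly_lift (B : pzAlgebra F) (b : 'I_n -> B) :
  (forall i j, b i * b j = b j * b i) ->
  exists f : poly_alg F n -> B,
    @alg_hom F (pz_of (poly_alg F n)) B f /\ forall i, f 'X_i = b i.
Proof.
move=> bC; pose h (m : 'X_{1..n}) : B := \prod_(i < n) b i ^+ m i.
have hM m1 m2 : h (m1 + m2)%MM = h m1 * h m2.
  rewrite /h; elim: (index_enum _) => [|i r IHr].
    by rewrite !big_nil mulr1.
  rewrite !big_cons IHr mnmDE exprD -!mulrA; congr (_ * _).
  rewrite [RHS]mulrA [LHS]mulrA; congr (_ * _).
  apply: commr_prod => j _; apply: commrX; apply/commr_sym/commrX; exact: bC.
have hU i : h U_(i)%MM = b i.
  have hUr r : uniq r -> \prod_(j <- r) b j ^+ U_(i)%MM j = if i \in r then b i else 1.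
    elim: r => [|j r IHr] /=; first by rewrite big_nil.
    case/andP=> jr /IHr {}IHr; rewrite big_cons IHr mnm1E inE eq_sym.
    case: (j =P i) => [<-|_] /=; first by rewrite (negPf jr) mulr1.
    by rewrite mul1r.
  by rewrite /h hUr ?index_enum_uniq // mem_index_enum.
pose f (p : poly_alg F n) : B := \sum_(m <- msupp p) p@_m *: h m.
have fE k p : (msize p <= k)%N -> f p = \sum_(m : 'X_{1..n < k}) p@_m *: h m.
  move=> le_pk; set I : subFinType _ := 'X_{1..n < k}.
  rewrite /f (big_mksub I) ?msupp_uniq //=; first last.
    by move=> x /msize_mdeg_lt /leq_trans; apply.
  by rewrite big_rmcond //= => j /memN_msupp_eq0 ->; rewrite scale0r.
have lf : linear f.
  move=> c p q; pose k := maxn (msize (c *: p + q)) (maxn (msize p) (msize q)).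
  rewrite !(fE k) ?leq_max ?leqnn ?orbT // scaler_sumr -big_split /=.
  by apply: eq_bigr => m _; rewrite mcoeffD mcoeffZ scalerDl scalerA.
have fX m : f 'X_[m] = h m.
  by rewrite /f msuppX big_seq1 mcoeffX eqxx scale1r.
exists f; split=> [|i]; last by rewrite fX hU.
split=> //; split=> [|p q].
  transitivity (f 'X_[0%MM]); first by rewrite mpolyX0.
  by rewrite fX /h big1 // => i _; rewrite mnm0E expr0.
apply: (mpoly_linear_ext (f := fun p => f (p * q)) (g := fun p => f p * f q)) => [c u v|c u v|k].
- by rewrite mulrDl -scalerAl lf.
- by rewrite lf linear_mulr.
apply: (mpoly_linear_ext (f := fun q => f ('X_[k] * q))
          (g := fun q => f 'X_[k] * f q)) => [c u v|c u v|l].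
- by rewrite mulrDr -scalerAr lf.
- by rewrite lf linear_mull.
by rewrite -mpolyXD !fX hM.
Qed.
End PolyLift.

Section LaurentFacts.
Variables (F : fieldType) (n : nat).
Local Notation L := (laurent F n).
Local Notation E := {ffun 'I_n -> int}.

Lemma laurent_linear_ext (V : lmodType F) (f g : L -> V) :
  linear f -> linear g -> (forall e, f (lmon F e) = g (lmon F e)) -> f =1 g.
Proof. move=> lf lg fg; exact: (malg_ext lf lg fg). Qed.

Lemma laurent_span (W : submodule L) : (forall e, W (lmon F e)) -> forall p, W p.
Proof.
move=> WX p; rewrite [X in W X]monalgE; apply: sub_mem_sum => m _.
rewrite mkmalgU_scale. exact: (sub_memZ _ (WX m)).
Qed.

Lemma ffun_expo1E (e : E) : e = \sum_i expo1 i *~ e i.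
Proof.
apply/ffunP => j; rewrite sum_ffunE (bigD1 j) //= big1 ?addr0 => [|i /negPf ij].
  by rewrite ffunMzE ffunE eqxx /= mulr1n intz.
by rewrite ffunMzE ffunE eq_sym ij mul0rz.
Qed.

(** Every exponent vector is reached from 0 by unit steps in both
    directions. *)
Lemma lmon_ind (P : E -> Prop) : P 0 ->
  (forall i e, P e -> P (expo1 i + e)) -> (forall i e, P e -> P (- expo1 i + e)) ->
  forall e, P e.
Proof.
move=> P0 PD PB e; rewrite (ffun_expo1E e).
elim/big_rec: _ => [//|i d _ Pd].
case: (e i) => k; rewrite ?NegzE ?mulrNz -pmulrn.
  by elim: k => [|k IHk]; rewrite ?mulr0n ?add0r // mulrS -addrA; apply: PD.
rewrite -mulNrn; elim: {k}k.+1 => [|k IHk]; first by rewrite mulr0n add0r.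
by rewrite mulrS -addrA; apply: PB.
Qed.

Lemma laurent_gen (W : submodule L) : W 1 ->
  (forall i f, W f -> W (lX F i * f)) -> (forall i f, W f -> W (lXV F i * f)) ->
  forall f, W f.
Proof.
move=> W1 WX WV; apply: laurent_span; apply: lmon_ind => // i e We.
  by rewrite lmonD; apply: WX.
by rewrite lmonD; apply: WV.
Qed.

Lemma generates_laurent :
  generates (fun p : pz_of (laurent_alg F n) =>
     (exists i, p = lX F i) \/ (exists i, p = lXV F i)).
Proof.
move=> W W1 WX; apply: laurent_gen => // i f Wf; apply: WX => //.
  by left; exists i.
by right; exists i.
Qed.
End LaurentFacts.

(** * Comparison of the rational and the trigonometric relations *)

Section Commutators.
Variable A : pzRingType.
Implicit Types a b c : A.

Lemma commutatorDl a b c : commutator (a + b) c = commutator a c + commutator b c.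
Proof. by rewrite /commutator mulrDl mulrDr opprD addrACA. Qed.
Lemma commutatorDr a b c : commutator c (a + b) = commutator c a + commutator c b.
Proof. by rewrite /commutator mulrDl mulrDr opprD addrACA. Qed.
Lemma commutatorNl a b : commutator (- a) b = - commutator a b.
Proof. by rewrite /commutator mulNr mulrN opprD. Qed.
Lemma commutatorN a b : commutator a b = - commutator b a.
Proof. by rewrite /commutator opprB. Qed.
Lemma commutator0P a b : commutator a b = 0 <-> a * b = b * a.
Proof. by split=> [/eqP|h]; rewrite /commutator ?subr_eq0 ?h ?subrr // => /eqP. Qed.
Lemma commutatorMl a b c :
  commutator (a * b) c = a * commutator b c + commutator a c * b.
Proof. by rewrite /commutator mulrBl mulrBr !mulrA addrA subrK. Qed.
Lemma commutatorMr a b c :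
  commutator a (b * c) = commutator a b * c + b * commutator a c.
Proof. by rewrite /commutator mulrBl mulrBr !mulrA addrA subrK. Qed.
Lemma comm_inverse a b c : b * c = 1 -> c * b = 1 -> a * b = b * a ->
  a * c = c * a.
Proof.
move=> bc cb ab; rewrite -[a * c]mul1r -cb -mulrA [b * _]mulrA -ab.
by rewrite -!mulrA bc mulr1.
Qed.
End Commutators.

Section Equivariance.
Variables (n : nat) (A : pzRingType) (s : 'S_n -> A).
Local Notation t i j := (tperm (i : 'I_n) (j : 'I_n)).
Implicit Types (i j k : 'I_n) (w : 'S_n).
Hypothesis s1 : s 1%g = 1.
Hypothesis sM : forall u v, s u * s v = s (v * u)%g.

(** The elements w with w Z_j w^-1 = Z_{w(j)} for all j are closed under
    products, and the simple transpositions generate S_n; a transposition (i j)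
    is reached by induction on j - i, conjugating (i j-1) by (j-1 j). *)
Lemma equivariant_of_simple (Z : 'I_n -> A) :
  (forall i i' j : 'I_n, i' = i.+1 :> nat ->
     s (t i i') * Z j = Z (t i i' j) * s (t i i')) ->
  forall w j, s w * Z j = Z (w j) * s w.
Proof.
move=> Zs.
have ZM u v : (forall j, s u * Z j = Z (u j) * s u) ->
  (forall j, s v * Z j = Z (v j) * s v) ->
  forall j, s (v * u)%g * Z j = Z ((v * u)%g j) * s (v * u)%g.
  by move=> Zu Zv j; rewrite -sM -mulrA Zv mulrA Zu permM mulrA.
have Zlt d : forall i j k : 'I_n, (j = (i + d).+1 :> nat)%N ->
    s (t i j) * Z k = Z (t i j k) * s (t i j).
  elim: d => [|d IHd] i j k jE; first by apply: Zs; rewrite jE addn0.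
  have ltm : ((i + d).+1 < n)%N by rewrite (leq_trans _ (ltn_ord j)) // jE addnS.
  pose m : 'I_n := Ordinal ltm.
  have -> : t i j = (t m j * t i m * t m j)%g.
    have -> : t i j = (t i m ^ t m j)%g.
      by rewrite tpermJ tpermL tpermD // -val_eqE /= ?jE; lia.
    by rewrite conjgE tpermV mulgA.
  have Zm l : s (t m j) * Z l = Z (t m j l) * s (t m j) by apply: Zs; rewrite /= jE addnS.
  by apply: (ZM _ _ Zm) => l; apply: (ZM _ _ _ Zm) => {}l; apply: IHd.
have Zt i j k : s (t i j) * Z k = Z (t i j k) * s (t i j).
  case: (ltngtP i j) => [ij|ji|/val_inj->].
  - by apply: (Zlt (j - i.+1)%N); lia.
  - by rewrite tpermC; apply: (Zlt (i - j.+1)%N); lia.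
  - by rewrite tperm1 perm1 s1 mul1r mulr1.
move=> w; have [ts -> _] := prod_tpermP w.
elim: ts => [|[i j] ts IHts] k; first by rewrite big_nil perm1 s1 mul1r mulr1.
by rewrite big_cons; apply: (ZM _ _ IHts) => l; apply: Zt.
Qed.

End Equivariance.

Section CherednikRelations.
Variables (F : fieldType) (n : nat) (A : pzAlgebra F).
Local Notation t i j := (tperm (i : 'I_n) (j : 'I_n)).
Implicit Types (i j k : 'I_n) (w : 'S_n).

(** The relations of F[x^{+-1}] x| S_n on generators.  An arbitrary algebra is
    used because the comparison serves both in the trigonometric algebra and in
    an algebra of operators. *)
Record perm_torus (X XV : 'I_n -> A) (s : 'S_n -> A) : Prop := PermTorus {
  pt_s1 : s 1%g = 1;
  pt_sM : forall u v, s u * s v = s (v * u)%g;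
  pt_sX : forall w i, s w * X i = X (w i) * s w;
  pt_XC : forall i j, X i * X j = X j * X i;
  pt_XK : forall i, X i * XV i = 1;
  pt_VK : forall i, XV i * X i = 1
}.

Variables (X XV : 'I_n -> A) (s : 'S_n -> A).
Hypothesis pt : perm_torus X XV s.
Let s1 := pt_s1 pt.
Let sM := pt_sM pt.
Let sX := pt_sX pt.
Let XC := pt_XC pt.
Let XK := pt_XK pt.
Let VK := pt_VK pt.

Lemma mulXI i : injective (fun a : A => X i * a).
Proof. by move=> a b /(congr1 (fun c => XV i * c)); rewrite !mulrA VK !mul1r. Qed.

Lemma pt_VC i j : XV i * X j = X j * XV i.
Proof. by apply: (@mulXI i); rewrite /= !mulrA XK mul1r XC -mulrA XK mulr1. Qed.

Lemma pt_sV w i : s w * XV i = XV (w i) * s w.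
Proof. by apply: (@mulXI (w i)); rewrite /= !mulrA XK mul1r -sX -mulrA XK mulr1. Qed.

Lemma s_transp w i j : s w * s (t i j) = s (t (w i) (w j)) * s w.
Proof. by rewrite !sM -tpermJ -conjgC. Qed.

Lemma s_transpK i j : s (t i j) * s (t i j) = 1.
Proof. by rewrite sM tperm2. Qed.

(** The Jucys--Murphy elements, which make up the difference between u_i and
    x_i y_i. *)
Definition murphy i : A := \sum_(j : 'I_n | (j < i)%N) s (t j i).

Lemma murphy_stable w i : w i = i -> (forall j, (w j < i)%N = (j < i)%N) ->
  s w * murphy i = murphy i * s w.
Proof.
move=> wi wlt; rewrite /murphy mulr_sumr mulr_suml.
rewrite [RHS](reindex_inj (@perm_inj _ w)) /=.
by apply: eq_big => [j|j _]; rewrite ?wlt // s_transp wi.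
Qed.

(** For i < j every transposition occurring in phi_i fixes j and permutes
    the indices below j, hence fixes phi_j. *)
Lemma murphy_comm i j : murphy i * murphy j = murphy j * murphy i.
Proof.
wlog ij : i j / (i < j)%N.
  move=> hw; case: (ltngtP i j) => [/hw//|/hw//|/val_inj->//].
rewrite [murphy i]/murphy mulr_suml mulr_sumr; apply: eq_bigr => k ki.
apply: murphy_stable => [|l].
  by rewrite tpermD // -val_eqE /=; lia.
case: tpermP => [->|->|//]; first by rewrite ij (ltn_trans ki).
by rewrite ij (ltn_trans ki).
Qed.

Lemma murphyS i i' : i' = i.+1 :> nat ->
  murphy i' = s (t i i') + \sum_(k : 'I_n | (k < i)%N) s (t k i').
Proof.
move=> i'E; rewrite /murphy (bigD1 i) ?i'E //=; congr (_ + _).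
by apply: eq_bigl => k; rewrite ltnS ltn_neqAle andbC.
Qed.

(** Conjugation by s_i turns phi_i into phi_{i+1} without its term s_i, and
    the missing term accounts for the constant 1 in the relations of u_i. *)
Lemma murphy_simple i i' : i' = i.+1 :> nat ->
  s (t i i') * murphy i = murphy i' * s (t i i') - 1.
Proof.
move=> i'E; rewrite (murphyS i'E) mulrDl s_transpK addrAC subrr add0r.
rewrite /murphy mulr_sumr mulr_suml; apply: eq_bigr => k ki.
by rewrite s_transp tpermL tpermD // -val_eqE /=; lia.
Qed.

Lemma murphy_simple' i i' : i' = i.+1 :> nat ->
  s (t i i') * murphy i' = murphy i * s (t i i') + 1.
Proof.
move=> i'E; have h := murphy_simple i'E.
rewrite -[RHS]mul1r -{1}(s_transpK i i') -!mulrA; congr (_ * _).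
by rewrite mulrDr mulr1 mulrA h mulrBl mul1r -mulrA s_transpK mulr1 subrK.
Qed.

Lemma murphy_far i i' j : i' = i.+1 :> nat -> j != i -> j != i' ->
  s (t i i') * murphy j = murphy j * s (t i i').
Proof.
move=> i'E ji ji'; apply: murphy_stable; first by rewrite tpermD // eq_sym.
by move: ji ji'; rewrite -!val_eqE /= => ji ji' k; case: tpermP => [->|->|//]; lia.
Qed.

Lemma murphyX_eq i :
  commutator (murphy i) (X i) =
  \sum_(k : 'I_n | (k < i)%N) X k * s (t k i) - X i * murphy i.
Proof.
rewrite /commutator /murphy mulr_suml; congr (_ - _).
by apply: eq_bigr => k _; rewrite sX tpermR.
Qed.

Lemma murphyX_lt i j : (j < i)%N ->
  commutator (murphy i) (X j) = X i * s (t j i) - X j * s (t j i).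
Proof.
move=> ji; rewrite /murphy (bigD1 j) //= commutatorDl.
rewrite {1}/commutator sX tpermL; set c := commutator _ _.
suff -> : c = 0 by rewrite addr0.
apply/commutator0P; rewrite mulr_suml mulr_sumr; apply: eq_bigr => k /andP[_ kj].
by rewrite sX tpermD // -val_eqE /=; lia.
Qed.

Lemma murphyX_gt i j : (i < j)%N -> commutator (murphy i) (X j) = 0.
Proof.
move=> ij; apply/commutator0P; rewrite /murphy mulr_suml mulr_sumr.
apply: eq_bigr => k ki.
by rewrite sX tpermD // -val_eqE /=; lia.
Qed.

Lemma sum_transp_neq i :
  \sum_(k : 'I_n | k != i) s (t i k) =
  murphy i + \sum_(k : 'I_n | (i < k)%N) s (t i k).
Proof.
rewrite (bigID (fun k : 'I_n => (k < i)%N)) /=; congr (_ + _).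
  apply: eq_big => [k|k _]; last by rewrite tpermC.
  by rewrite -val_eqE /=; lia.
by apply: eq_bigl => k; rewrite -val_eqE /=; lia.
Qed.

Variable kappa : F.

(** Equivariance is required for all of S_n here, and for simple reflections
    only in the presentation; [equivariant_of_simple] bridges the two. *)
Record rational_rels (Y : 'I_n -> A) : Prop := RationalRels {
  rr_sY : forall w i, s w * Y i = Y (w i) * s w;
  rr_eq : forall i, commutator (Y i) (X i) =
     kappa *: (1 : A) + \sum_(k : 'I_n | k != i) s (t i k);
  rr_neq : forall i j, i != j -> commutator (Y i) (X j) = - s (t i j)
}.

Record trig_rels (U : 'I_n -> A) : Prop := TrigRels {
  tr_su : forall i i', i' = i.+1 :> nat ->
     s (t i i') * U i = U i' * s (t i i') - 1;
  tr_su' : forall i i', i' = i.+1 :> nat ->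
     s (t i i') * U i' = U i * s (t i i') + 1;
  tr_suj : forall i i' j, i' = i.+1 :> nat -> j != i -> j != i' ->
     s (t i i') * U j = U j * s (t i i');
  tr_eq : forall i, commutator (U i) (X i) =
      kappa *: X i + \sum_(k : 'I_n | (k < i)%N) X k * s (t k i)
                   + \sum_(k : 'I_n | (i < k)%N) X i * s (t i k);
  tr_gt : forall i j, (j < i)%N -> commutator (U i) (X j) = - (X j * s (t j i));
  tr_lt : forall i j, (i < j)%N -> commutator (U i) (X j) = - (X i * s (t i j))
}.

Lemma commYX (Z : 'I_n -> A) i j :
  commutator (XV i * Z i) (X j) = XV i * commutator (Z i) (X j).
Proof. by rewrite commutatorMl {2}/commutator pt_VC subrr mul0r addr0. Qed.

(** Both the commutators with u_i and those with phi_i distinguish the cases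
    j < i and i < j; the asymmetries cancel in u_i - phi_i. *)
Lemma rational_of_trig U : trig_rels U ->
  rational_rels (fun i => XV i * (U i - murphy i)).
Proof.
move=> tr; set Z := fun i => U i - murphy i.
have sZ : forall w j, s w * Z j = Z (w j) * s w.
  apply: (equivariant_of_simple s1 sM) => i i' j i'E; rewrite /Z mulrBr.
  case: tpermP => [->|->|/eqP ji /eqP ji'].
  - by rewrite tr_su // murphy_simple // mulrBl opprB addrA subrK.
  - by rewrite tr_su' // murphy_simple' // mulrBl opprD addrACA subrr addr0.
  - by rewrite tr_suj // murphy_far // mulrBl.
split=> [w i|i|i j ij].
- by rewrite mulrA pt_sV -mulrA sZ mulrA.
- rewrite (commYX Z); apply: (@mulXI i); rewrite /= mulrA XK mul1r.
  rewrite /Z commutatorDl commutatorNl tr_eq // -mulr_sumr murphyX_eq sum_transp_neq.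
  rewrite !mulrDr -pzscalerAr mulr1 opprB.
  by rewrite -!addrA; congr (_ + _); rewrite addrC -addrA subrK addrC.
- rewrite (commYX Z); apply: (@mulXI i); rewrite /= mulrA XK mul1r mulrN.
  rewrite /Z commutatorDl commutatorNl; case: (ltngtP i j) => [lt_ij|lt_ji|/val_inj eq_ij].
  + by rewrite tr_lt // murphyX_gt // subr0.
  + by rewrite tr_gt // murphyX_lt // opprB addKr tpermC.
  + by rewrite eq_ij eqxx in ij.
Qed.

Lemma trig_of_rational Y : rational_rels Y ->
  trig_rels (fun i => X i * Y i + murphy i).
Proof.
move=> rr; set U := fun i => X i * Y i + murphy i.
have sZ w i : s w * (X i * Y i) = X (w i) * Y (w i) * s w.
  by rewrite mulrA sX -mulrA rr_sY // mulrA.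
have ZX i j : commutator (X i * Y i) (X j) = X i * commutator (Y i) (X j).
  by rewrite commutatorMl {2}/commutator XC subrr mul0r addr0.
split=> [i i' i'E|i i' i'E|i i' j i'E ji ji'|i|i j ji|i j ij]; rewrite /U.
- by rewrite mulrDr sZ tpermL murphy_simple // addrA mulrDl.
- by rewrite mulrDr sZ tpermR murphy_simple' // addrA mulrDl.
- by rewrite mulrDr sZ tpermD 1?eq_sym // murphy_far // mulrDl.
- rewrite commutatorDl ZX rr_eq // murphyX_eq sum_transp_neq.
  rewrite -mulr_sumr !mulrDr -pzscalerAr mulr1.
  by rewrite -!addrA; congr (_ + _); rewrite addrC -addrA subrK addrC.
- rewrite commutatorDl ZX rr_neq ?neq_ltn ?ji ?orbT // murphyX_lt // mulrN tpermC.
  by rewrite addrA addNr add0r.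
- by rewrite commutatorDl ZX rr_neq ?neq_ltn ?ij // murphyX_gt // mulrN addr0.
Qed.

(** With z_i = x_i y_i one has
    [z_i, z_j] = x_i x_j [y_i, y_j] - s_ij (z_j - z_i), while
    [z_i, phi_j] = s_ij (z_j - z_i), since s_ij is the only term of phi_j that
    moves i; the remaining commutators vanish. *)
Lemma commutator_trig Y i j : rational_rels Y -> (i < j)%N ->
  commutator (X i * Y i + murphy i) (X j * Y j + murphy j) =
  X i * X j * commutator (Y i) (Y j).
Proof.
move=> rr ij; set Z := fun i => X i * Y i.
have nij : i != j by rewrite neq_ltn ij.
have sZ w k : s w * Z k = Z (w k) * s w.
  by rewrite /Z mulrA sX -mulrA rr_sY // mulrA.
have cZ : commutator (Z i) (Z j) =
    X i * X j * commutator (Y i) (Y j) - s (t i j) * Z j + s (t i j) * Z i.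
  have YX k l : k != l -> Y k * X l = X l * Y k - s (t k l).
    by move=> kl; rewrite -(rr_neq rr kl) /commutator addrCA subrr addr0.
  rewrite /commutator /Z -!mulrA [Y i * _]mulrA [Y j * (X i * _)]mulrA.
  rewrite !YX // 1?eq_sym // [t j i]tpermC !mulrBl !mulrBr opprB.
  rewrite [X i * (s _ * _)]mulrA [X j * (s _ * _)]mulrA.
  have XsE : X i * s (t i j) = s (t i j) * X j by rewrite sX tpermR.
  have XsE' : X j * s (t i j) = s (t i j) * X i by rewrite sX tpermL.
  rewrite XsE XsE' -!mulrA [X j * (X i * _)]mulrA XC -mulrA.
  by rewrite -!addrA; congr (_ + _); rewrite [RHS]addrC -!addrA.
have cZm : commutator (Z i) (murphy j) = s (t i j) * Z j - s (t i j) * Z i.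
  rewrite /murphy (bigD1 i) //= commutatorDr.
  rewrite {1}/commutator [s _ * Z i]sZ tpermL sZ tpermR; set c := commutator _ _.
  suff -> : c = 0 by rewrite addr0.
  apply/commutator0P; rewrite mulr_suml mulr_sumr; apply: eq_bigr => k /andP[_ ki].
  by rewrite sZ tpermD // eq_sym.
have cmZ : commutator (murphy i) (Z j) = 0.
  apply/commutator0P; rewrite /murphy mulr_suml mulr_sumr; apply: eq_bigr => k ki.
  by rewrite sZ tpermD // -val_eqE /=; lia.
rewrite !(commutatorDl, commutatorDr) cZ cZm cmZ.
have -> : commutator (murphy i) (murphy j) = 0 by apply/commutator0P/murphy_comm.
by rewrite !addr0 -addrA [_ + (_ - _)]addrC subrK subrK.
Qed.

Lemma trig_comm_iff Y : rational_rels Y ->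
  (forall i j, commutator (Y i) (Y j) = 0) <->
  (forall i j, commutator (X i * Y i + murphy i) (X j * Y j + murphy j) = 0).
Proof.
move=> rr; split=> h i j.
  wlog ij : i j / (i < j)%N.
    move=> hw; case: (ltngtP i j) => [/hw//|/hw ji|/val_inj->].
      by rewrite commutatorN ji oppr0.
    by rewrite /commutator subrr.
  by rewrite commutator_trig // h mulr0.
wlog ij : i j / (i < j)%N.
  move=> hw; case: (ltngtP i j) => [/hw//|/hw ji|/val_inj->].
    by rewrite commutatorN ji oppr0.
  by rewrite /commutator subrr.
have := h i j; rewrite commutator_trig // -mulrA => h0.
apply: (@mulXI j); apply: (@mulXI i); rewrite /= h0.
by rewrite !mulr0.
Qed.

(** By the Jacobi identity the left side is
    [[Y_i, X_k], Y_j] + [Y_i, [Y_j, X_k]].  If k is neither i nor j, both terms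
    are commutators of a Y with a permutation that fixes its index.  If k = i,
    only s_ij contributes, and its two contributions cancel by
    equivariance. *)
Lemma commYY_X Y i j k : rational_rels Y ->
  commutator (commutator (Y i) (Y j)) (X k) = 0.
Proof.
move=> rr.
have jac a b c : commutator (commutator a b) c =
    commutator (commutator a c) b + commutator a (commutator b c) :> A.
  rewrite [commutator a b]/commutator commutatorDl commutatorNl !commutatorMl.
  move: (commutator a c) (commutator b c) => p q.
  by rewrite opprD [a * q + _]addrC addrACA.
have Yfix w l : w l = l -> commutator (s w) (Y l) = 0.
  by move=> wl; apply/commutator0P; rewrite (rr_sY rr) wl.
have Ynn l m : l != m -> k != l -> k != m ->
    commutator (commutator (Y l) (Y m)) (X k) = 0.
  move=> lm kl km; rewrite jac !(rr_neq rr) 1?eq_sym // commutatorNl.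
  rewrite [commutator (Y l) _]commutatorN commutatorNl !Yfix ?oppr0 ?addr0 //.
    by rewrite tpermD // eq_sym.
  by rewrite tpermD.
have Yeq m : k != m -> commutator (commutator (Y k) (Y m)) (X k) = 0.
  move=> km; have mk : m != k by rewrite eq_sym.
  rewrite jac (rr_eq rr) (rr_neq rr) // (bigD1 m) //=.
  rewrite !commutatorDl [commutator (Y k) _]commutatorN commutatorNl opprK.
  have -> : commutator (kappa *: (1 : A)) (Y m) = 0.
    by apply/commutator0P; rewrite -pzscalerAl -pzscalerAr mul1r mulr1.
  have -> : commutator (\sum_(l < n | (l != k) && (l != m)) s (t k l)) (Y m) = 0.
    apply/commutator0P; rewrite mulr_suml mulr_sumr; apply: eq_bigr => l /andP[_ lm].
    by rewrite (rr_sY rr) tpermD.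
  rewrite add0r addr0 /commutator [t m k]tpermC !(rr_sY rr) tpermL tpermR.
  by rewrite addrA subrK subrr.
case: (i =P j) => [->|/eqP ij].
  by rewrite /commutator subrr mul0r mulr0 subrr.
have [ki|ki] := eqVneq k i; first by rewrite -ki Yeq // ki.
have [kj|kj] := eqVneq k j; last exact: Ynn.
by rewrite -kj [commutator (Y i) _]commutatorN commutatorNl Yeq ?oppr0.
Qed.
Lemma rational_comm_of_trig U : trig_rels U ->
  (forall i j, commutator (U i) (U j) = 0) ->
  forall i j, commutator (XV i * (U i - murphy i)) (XV j * (U j - murphy j)) = 0.
Proof.
move=> tr UC; apply/(trig_comm_iff (rational_of_trig tr)) => i j.
by rewrite !mulrA !XK !mul1r !subrK.
Qed.
End CherednikRelations.

(** * Divided differences and derivations of Laurent polynomials *)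

(** If d divides f - sf and g - sg it divides fg - sf sg: the reason why
    divisibility of f - sf needs to be checked on generators only. *)
Lemma twisted_leibniz (R : comPzRingType) (d f g sf sg df dg : R) :
  d * df = f - sf -> d * dg = g - sg -> d * (df * g + sf * dg) = f * g - sf * sg.
Proof.
by move=> hf hg; rewrite mulrDr mulrA hf mulrCA hg mulrBl mulrBr addrA subrK.
Qed.

Section DividedDifferences.
Variables (F : fieldType) (n : nat) (L : comAlgType F).
Local Notation t i k := (tperm (i : 'I_n) (k : 'I_n)).

(** The properties of the Laurent polynomial ring that divided differences
    depend on.  Working with these keeps the concrete ring, whose product is a
    double sum over exponents, out of the computations. *)
Record torus_ring (x xV : 'I_n -> L) (sym : 'S_n -> L -> L) : Prop := TorusRing {
  tr_xV : forall i, x i * xV i = 1;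
  tr_gen : forall W : submodule L, W 1 -> (forall i f, W f -> W (x i * f)) ->
     (forall i f, W f -> W (xV i * f)) -> forall f, W f;
  tr_lreg : forall i k f, i != k -> (x i - x k) * f = 0 -> f = 0;
  tr_lin : forall w, linear (sym w);
  tr_symM : forall w, {morph sym w : f g / f * g};
  tr_sym1 : forall w, sym w 1 = 1;
  tr_symid : forall f, sym 1%g f = f;
  tr_comp : forall u v f, sym (v * u)%g f = sym u (sym v f);
  tr_symX : forall w i, sym w (x i) = x (w i)
}.

Variables (x xV : 'I_n -> L) (sym : 'S_n -> L -> L).
Hypothesis tr : torus_ring x xV sym.

Lemma sym_xV w i : sym w (xV i) = xV (w i).
Proof.
rewrite -[LHS]mul1r -(tr_xV tr (w i)) mulrAC -(tr_symX tr) -(tr_symM tr).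
by rewrite (tr_xV tr) (tr_sym1 tr) mul1r.
Qed.

Lemma comm_mull_linear (f : L) : linear (fun g : L => f * g).
Proof. by move=> c g h; rewrite mulrDr -scalerAr. Qed.

Lemma x_sub_inj i k (f g : L) : i != k ->
  (x i - x k) * f = (x i - x k) * g -> f = g.
Proof.
move=> ik /eqP; rewrite -subr_eq0 -mulrBr => /eqP /(tr_lreg tr ik)/eqP.
by rewrite subr_eq0 => /eqP.
Qed.

(** On generators, x_i - x_k divides x_j - s_ik x_j, and also
    x_i^-1 - x_k^-1 = - (x_i - x_k) / (x_i x_k).  The value 0 for i = k makes
    the divided difference linear for all indices. *)
Lemma divided_difference_exists i k (f : L) : exists g : L,
  (i = k -> g = 0) /\ (x i - x k) * g = f - sym (t i k) f.
Proof.
have [<-|ik] := eqVneq i k.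
  by exists 0; rewrite mulr0 tperm1 (tr_symid tr) subrr.
suff [g gE] : exists g : L, (x i - x k) * g = f - sym (t i k) f.
  by exists g; split=> // /eqP; rewrite (negPf ik).
pose a (f : L) := f - sym (t i k) f.
have la : linear a.
  by move=> c g h; rewrite /a (tr_lin tr) scalerBr opprD addrACA.
have lm : linear (fun g : L => (x i - x k) * g) by exact: comm_mull_linear.
have aM g h : (exists g', (x i - x k) * g' = a g) ->
    (exists h', (x i - x k) * h' = a h) -> exists p, (x i - x k) * p = a (g * h).
  move=> [g' g'E] [h' h'E]; exists (g' * h + sym (t i k) g * h').
  by rewrite /a (tr_symM tr); apply: twisted_leibniz.
apply: (tr_gen tr (W := preim_sub la (range_sub lm))) => /= [|j h IHh|j h IHh].
- by exists 0; rewrite mulr0 /a (tr_sym1 tr) subrr.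
- apply: aM => //; rewrite /a (tr_symX tr).
  case: tpermP => [->|->|_ _].
  + by exists 1; rewrite mulr1.
  + by exists (- 1); rewrite mulrN1 opprB.
  + by exists 0; rewrite mulr0 subrr.
- apply: aM => //; rewrite /a sym_xV.
  have xx : (x i - x k) * (xV i * xV k) = xV k - xV i.
    rewrite mulrBl mulrA (tr_xV tr) mul1r [xV i * _]mulrC mulrA (tr_xV tr).
    by rewrite mul1r.
  case: tpermP => [->|->|_ _].
  + by exists (- (xV i * xV k)); rewrite mulrN xx opprB.
  + by exists (xV i * xV k).
  + by exists 0; rewrite mulr0 subrr.
Qed.

Definition divided_difference i k (f : L) : L :=
  projT1 (cid (divided_difference_exists i k f)).
Local Notation dd := divided_difference.

Lemma divided_difference_diag i f : dd i i f = 0.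
Proof. by rewrite /dd; case: cid => g [/= ->]. Qed.
Lemma divided_differenceE i k f : (x i - x k) * dd i k f = f - sym (t i k) f.
Proof. by rewrite /dd; case: cid => g []. Qed.

Lemma divided_difference_linear i k : linear (dd i k).
Proof.
have [<-|ik] := eqVneq i k; first by move=> c f g; rewrite !divided_difference_diag scaler0 addr0.
move=> c f g; apply: (x_sub_inj ik); rewrite comm_mull_linear !divided_differenceE.
by rewrite (tr_lin tr) scalerBr opprD addrACA.
Qed.

Lemma divided_difference_one i k : dd i k 1 = 0.
Proof.
have [<-|ik] := eqVneq i k; first by rewrite divided_difference_diag.
by apply: (x_sub_inj ik); rewrite divided_differenceE (tr_sym1 tr) subrr mulr0.
Qed.

(** This and the lemmas around it hold because they do after multiplication
    by x_i - x_k, which is cancellable. *)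
Lemma divided_difference_x i k j f : i != k ->
  dd i k (x j * f) = x j * dd i k f + ((j == i)%:R - (j == k)%:R) * sym (t i k) f.
Proof.
move=> ik; apply: (x_sub_inj ik).
rewrite mulrDr mulrCA !divided_differenceE (tr_symM tr) (tr_symX tr).
have xj : (x i - x k) * ((j == i)%:R - (j == k)%:R) = x j - x (t i k j).
  case: tpermP => [->|->|/eqP/negPf-> /eqP/negPf->].
  - by rewrite eqxx (negPf ik) subr0 mulr1.
  - by rewrite eqxx [k == i]eq_sym (negPf ik) sub0r mulrN1 opprB.
  - by rewrite !subrr mulr0.
by rewrite [in RHS]mulrA xj mulrBr mulrBl addrA subrK.
Qed.

Lemma divided_difference_sym w i k f : sym w (dd i k f) = dd (w i) (w k) (sym w f).
Proof.
have symB : {morph sym w : f g / f - g} by exact: linB (tr_lin tr w).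
have [<-|ik] := eqVneq i k; first by rewrite !divided_difference_diag (lin0 (tr_lin tr w)).
have wik : w i != w k by rewrite (inj_eq perm_inj).
apply: (x_sub_inj wik); rewrite divided_differenceE -!(tr_symX tr).
rewrite -symB -(tr_symM tr) divided_differenceE symB.
by rewrite -!(tr_comp tr) -tpermJ -conjgC.
Qed.
End DividedDifferences.

Section LaurentCalculus.
Variables (F : fieldType) (n : nat).
Local Notation L := (laurent F n).
Local Notation E := {ffun 'I_n -> int}.
Local Notation x i := (lX F (i : 'I_n)).
Local Notation xV i := (lXV F (i : 'I_n)).
Local Notation lmull := (@comm_mull_linear F (laurent F n)).

Lemma mcoeff_lmonM (d e : E) (f : L) :
  monalg.mcoeff e (lmon F d * f) = monalg.mcoeff (e - d) f.
Proof.
have lin1 : linear (fun f : L => monalg.mcoeff e (lmon F d * f) : F^o).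
  by move=> c g h; rewrite /= lmull monalg.mcoeffD monalg.mcoeffZ.
have lin2 : linear (fun f : L => monalg.mcoeff (e - d) f : F^o).
  by move=> c g h; rewrite monalg.mcoeffD monalg.mcoeffZ.
apply: (laurent_linear_ext lin1 lin2) => d'.
by rewrite -lmonD !monalg.mcoeffU addrC -[d' == _]eq_sym subr_eq eq_sym.
Qed.

(** If (x_i - x_k) f = 0, the coefficients of f are constant along the
    infinite progressions of direction e_i - e_k; as f has finitely many
    nonzero coefficients, all are 0. *)
Lemma lX_sub_lreg i k (f : L) : i != k -> (x i - x k) * f = 0 -> f = 0.
Proof.
move=> ik /eqP; rewrite mulrBl subr_eq0 => /eqP eqf.
pose c (e : E) : F := monalg.mcoeff e f.
pose d : E := expo1 i - expo1 k.
have fix_f : lmon F (- d) * f = f.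
  have -> : - d = - expo1 i + expo1 k by rewrite /d opprB addrC.
  rewrite (lmonD F (- expo1 i) (expo1 k)) -[lmon F (expo1 k)]/(x k).
  rewrite -[lmon F (- expo1 i)]/(xV i).
  by rewrite -mulrA -eqf mulrA [xV i * _]mulrC lX_lXV mul1r.
have step e : c (e + d) = c e by rewrite /c -[in RHS]fix_f mcoeff_lmonM opprK.
have shift e m : c (e + d *+ m) = c e.
  elim: m => [|m <-]; first by rewrite mulr0n addr0.
  by rewrite mulrSr addrA step.
apply/malgP => e; rewrite monalg.mcoeff0 -[LHS]/(c e); apply/eqP/negPn/negP => fe.
pose r := [seq e + d *+ m | m <- iota 0 (size (monalg.msupp f)).+1].
have ur : uniq r.
  rewrite map_inj_uniq ?iota_uniq // => m1 m2 /addrI /ffunP/(_ i).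
  by rewrite !ffunMnE !ffunE eqxx (negPf ik) subr0 => /eqP; rewrite Num.Theory.eqr_nat => /eqP.
suff /(uniq_leq_size ur) : {subset r <= monalg.msupp f}.
  by rewrite size_map size_iota ltnn.
move=> _ /mapP[m _ ->]; rewrite -monalg.mcoeff_neq0 -[monalg.mcoeff _ _]/(c _).
by rewrite shift.
Qed.

Lemma laurent_torus_ring : torus_ring (@lX F n) (@lXV F n) (@lsym F n).
Proof.
split.
- exact: lX_lXV.
- exact: laurent_gen.
- exact: lX_sub_lreg.
- exact: lsym_linear.
- by move=> w; exact: (lsym_alg_hom F w).2.2.
- by move=> w; exact: (lsym_alg_hom F w).2.1.
- exact: lsym_id.
- by move=> u v f; exact: lsym_comp.
- exact: lsym_lX.
Qed.

Definition laurent_deriv (i : 'I_n) : L -> L :=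
  mlin (fun e : E => (e i)%:~R *: lmon F (e - expo1 i)).

Lemma laurent_deriv_linear i : linear (laurent_deriv i).
Proof. exact: mlin_linear. Qed.
Lemma laurent_deriv_mon i e : laurent_deriv i (lmon F e) = (e i)%:~R *: lmon F (e - expo1 i).
Proof. exact: mlinU. Qed.

Lemma laurent_deriv_one i : laurent_deriv i 1 = 0.
Proof. by rewrite -[1]/(lmon F 0) laurent_deriv_mon ffunE scale0r. Qed.

Lemma laurent_deriv_lX i j f :
  laurent_deriv i (x j * f) = x j * laurent_deriv i f + (j == i)%:R * f.
Proof.
apply: (laurent_linear_ext (f := fun f => laurent_deriv i (x j * f))
         (g := fun f => x j * laurent_deriv i f + (j == i)%:R * f)) => [c g h|c g h|e].
- by rewrite (lmull (x j)) laurent_deriv_linear.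
- by rewrite laurent_deriv_linear (lmull (x j)) (lmull (j == i)%:R) scalerDr addrACA.
rewrite -(lmonD F (expo1 j) e).
rewrite !laurent_deriv_mon -scalerAr.
have -> : x j * lmon F (e - expo1 i) = lmon F (expo1 j + e - expo1 i).
  by rewrite -addrA; apply/esym/lmonD.
rewrite !ffunE rmorphD scalerDl addrC; congr (_ + _).
rewrite eq_sym; case: eqP => [->|_]; last by rewrite scale0r mul0r.
by rewrite scale1r mul1r addrAC subrr add0r.
Qed.

Lemma laurent_deriv_sym w i f : lsym w (laurent_deriv i f) = laurent_deriv (w i) (lsym w f).
Proof.
apply: (laurent_linear_ext (f := fun f => lsym w (laurent_deriv i f))
         (g := fun f => laurent_deriv (w i) (lsym w f))) => [c g h|c g h|e].
- by rewrite laurent_deriv_linear lsym_linear.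
- by rewrite lsym_linear laurent_deriv_linear.
rewrite laurent_deriv_mon lsym_mon laurent_deriv_mon (linZ (@lsym_linear F n w)).
rewrite lsym_mon ffunE permK.
congr (_ *: lmon F _); apply/ffunP => j; rewrite !ffunE.
by rewrite (can2_eq (permKV w) (permK w)).
Qed.
End LaurentCalculus.

(** * The algebra of endomorphisms of a vector space *)

Section Endomorphisms.
Variables (F : fieldType) (V : lmodType F).

Record endo := Endo { endo_fun :> V -> V; endo_linear : linear endo_fun }.

Lemma endoP (f g : endo) : f =1 g -> f = g.
Proof.
case: f g => [f lf] [g lg] /= /funext fg; case: _ / fg in lg *.
by congr Endo; apply: Prop_irrelevance.
Qed.

HB.instance Definition _ := gen_eqMixin endo.
HB.instance Definition _ := gen_choiceMixin endo.

Lemma endo0_linear : linear (fun _ : V => 0 : V).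
Proof. by move=> c u v; rewrite scaler0 addr0. Qed.
Lemma endoD_linear (f g : endo) : linear (fun v => f v + g v).
Proof. by move=> c u v; rewrite !endo_linear scalerDr addrACA. Qed.
Lemma endoN_linear (f : endo) : linear (fun v => - f v).
Proof. by move=> c u v; rewrite endo_linear opprD scalerN. Qed.
Lemma endoZ_linear c (f : endo) : linear (fun v => c *: f v).
Proof. by move=> d u v; rewrite endo_linear scalerDr !scalerA mulrC. Qed.
Lemma endo1_linear : linear (fun v : V => v). Proof. by []. Qed.
Lemma endoM_linear (f g : endo) : linear (fun v => f (g v)).
Proof. by move=> c u v; rewrite !endo_linear. Qed.

Definition endo_zero := Endo endo0_linear.
Definition endo_add f g := Endo (endoD_linear f g).
Definition endo_opp f := Endo (endoN_linear f).
Definition endo_scale c f := Endo (endoZ_linear c f).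
Definition endo_one := Endo endo1_linear.
Definition endo_mul f g := Endo (endoM_linear f g).

Fact endo_addA : associative endo_add.
Proof. by move=> f g h; apply: endoP => v /=; rewrite addrA. Qed.
Fact endo_addC : commutative endo_add.
Proof. by move=> f g; apply: endoP => v /=; rewrite addrC. Qed.
Fact endo_add0 : left_id endo_zero endo_add.
Proof. by move=> f; apply: endoP => v /=; rewrite add0r. Qed.
Fact endo_addN : left_inverse endo_zero endo_opp endo_add.
Proof. by move=> f; apply: endoP => v /=; rewrite addNr. Qed.
HB.instance Definition _ := GRing.isZmodule.Build endo
  endo_addA endo_addC endo_add0 endo_addN.

Fact endo_scaleA c d f : endo_scale c (endo_scale d f) = endo_scale (c * d) f.
Proof. by apply: endoP => v /=; rewrite scalerA. Qed.
Fact endo_scale1 : left_id 1 endo_scale.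
Proof. by move=> f; apply: endoP => v /=; rewrite scale1r. Qed.
Fact endo_scaleDr : right_distributive endo_scale +%R.
Proof. by move=> c f g; apply: endoP => v /=; rewrite scalerDr. Qed.
Fact endo_scaleDl f : {morph endo_scale^~ f : c d / c + d}.
Proof. by move=> c d; apply: endoP => v /=; rewrite scalerDl. Qed.
HB.instance Definition _ := GRing.Zmodule_isLmodule.Build F endo
  endo_scaleA endo_scale1 endo_scaleDr endo_scaleDl.

Fact endo_mulA : associative endo_mul. Proof. by move=> f g h; apply: endoP. Qed.
Fact endo_mul1 : left_id endo_one endo_mul. Proof. by move=> f; apply: endoP. Qed.
Fact endo_1mul : right_id endo_one endo_mul. Proof. by move=> f; apply: endoP. Qed.
Fact endo_linl h : linear (endo_mul^~ h).
Proof. by move=> c f g; apply: endoP. Qed.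
Fact endo_linr h : linear (endo_mul h).
Proof. by move=> c f g; apply: endoP => v /=; rewrite endo_linear. Qed.

Definition End_alg : pzAlgebra F :=
  PzAlgebra (AlgStructure endo_mulA endo_mul1 endo_1mul endo_linl endo_linr).

Definition eval (f : End_alg) (v : V) : V := endo_fun f v.
Arguments eval : simpl never.

Lemma End_algP (f g : End_alg) : eval f =1 eval g -> f = g.
Proof. exact: endoP. Qed.
Lemma evalM (f g : End_alg) v : eval (f * g) v = eval f (eval g v).
Proof. by []. Qed.
Lemma eval1 v : eval 1 v = v. Proof. by []. Qed.
Lemma evalD (f g : End_alg) v : eval (f + g) v = eval f v + eval g v.
Proof. by []. Qed.
Lemma evalN (f : End_alg) v : eval (- f) v = - eval f v.
Proof. by []. Qed.
Lemma evalZ c (f : End_alg) v : eval (c *: f) v = c *: eval f v.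
Proof. by []. Qed.
Lemma eval_linear v : linear (eval^~ v).
Proof. by []. Qed.
Lemma eval_lin (f : End_alg) : linear (eval f).
Proof. exact: endo_linear. Qed.
Lemma eval_sum (I : Type) (r : seq I) (P : pred I) (G : I -> End_alg) v :
  eval (\sum_(i <- r | P i) G i) v = \sum_(i <- r | P i) eval (G i) v.
Proof. exact: (lin_sum (eval_linear v)). Qed.
End Endomorphisms.

(** * The module induced from F[y] x| S_n, and its Dunkl operators *)

Section YPerm.
Variable n : nat.

(** A pair (m, w) stands for y^m w.  These form a basis of F[y] x| S_n that is
    permuted by left multiplication by y_i and by permutations, so these act on
    the basis itself. *)
Definition ymon_perm : Type := ('X_{1..n} * 'S_n)%type.
HB.instance Definition _ := Choice.on ymon_perm.

Definition y_act (i : 'I_n) (b : ymon_perm) : ymon_perm := ((U_(i) + b.1)%MM, b.2).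
Definition perm_act (w : 'S_n) (b : ymon_perm) : ymon_perm :=
  ([multinom b.1 ((w^-1)%g i) | i < n], (b.2 * w)%g).

Lemma y_actC i j b : y_act i (y_act j b) = y_act j (y_act i b).
Proof. by congr (_, _); apply/mnmP => k; rewrite !mnmDE addnCA. Qed.
Lemma perm_act1 b : perm_act 1%g b = b.
Proof.
case: b => m w; congr (_, _); last by rewrite /= mulg1.
by apply/mnmP => k; rewrite mnmE /= invg1 perm1.
Qed.
Lemma perm_actM u v b : perm_act u (perm_act v b) = perm_act (v * u)%g b.
Proof.
congr (_, _); last by rewrite /= mulgA.
by apply/mnmP => k; rewrite /perm_act /= !mnmE invMg permM.
Qed.
Lemma perm_act_y w i b : perm_act w (y_act i b) = y_act (w i) (perm_act w b).
Proof.
congr (_, _); apply/mnmP => k; rewrite /y_act /perm_act /= mnmE !mnmDE mnmE !mnm1E.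
by rewrite (can2_eq (permK w) (permKV w)).
Qed.
End YPerm.

Section Induced.
Variables (F : fieldType) (n : nat) (kappa : F) (L : comAlgType F).
Local Notation t i k := (tperm (i : 'I_n) (k : 'I_n)).
Local Notation ymon_perm := (ymon_perm n).

(** The partial derivatives, characterized by the Leibniz rule on the
    variables. *)
Record equivariant_partials (x : 'I_n -> L) (sym : 'S_n -> L -> L)
    (d : 'I_n -> L -> L) : Prop := EquivariantPartials {
  ep_lin : forall i, linear (d i);
  ep_one : forall i, d i 1 = 0;
  ep_x : forall i j f, d i (x j * f) = x j * d i f + (j == i)%:R * f;
  ep_sym : forall w i f, sym w (d i f) = d (w i) (sym w f)
}.

(** M is L (x) F[B], and basis_tens f b is f (x) b.  The last field builds the
    operators a (x) beta. *)
Record free_over (B : Type) (M : lmodType F) (basis_tens : L -> B -> M) : Prop := FreeOver {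
  fo_lin : forall b, linear (basis_tens^~ b);
  fo_ext : forall f g : M -> M, linear f -> linear g ->
    (forall p b, f (basis_tens p b) = g (basis_tens p b)) -> f =1 g;
  fo_map : forall (a : L -> L) (beta : B -> B), linear a ->
    exists o : End_alg M, forall p b,
      eval o (basis_tens p b) = basis_tens (a p) (beta b)
}.

Lemma id_linear (V : lmodType F) : linear (@id V). Proof. by []. Qed.

Variables (x xV : 'I_n -> L) (sym : 'S_n -> L -> L) (d : 'I_n -> L -> L).
Variables (M : lmodType F) (basis_tens : L -> ymon_perm -> M).
Hypothesis tr : torus_ring x xV sym.
Hypothesis ep : equivariant_partials x sym d.
Hypothesis fo : free_over basis_tens.
Local Notation dd := (divided_difference tr).
Let tl := fo_lin fo.

Lemma tensor_op_ext (f g : End_alg M) :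
  (forall p b, eval f (basis_tens p b) = eval g (basis_tens p b)) -> f = g.
Proof. by move=> fg; apply: End_algP; apply: (fo_ext fo) => //; exact: eval_lin. Qed.

Definition tensor_op (a : L -> L) (beta : ymon_perm -> ymon_perm) (la : linear a) : End_alg M :=
  projT1 (cid (fo_map fo beta la)).
Lemma tensor_opE a beta la p b : eval (@tensor_op a beta la) (basis_tens p b) =
  basis_tens (a p) (beta b).
Proof. by rewrite /tensor_op; case: cid. Qed.

Definition mul_op (f : L) : End_alg M := tensor_op id (comm_mull_linear f).
Definition perm_op (w : 'S_n) : End_alg M := tensor_op (perm_act w) (tr_lin tr w).
Definition dunkl_op (i : 'I_n) : End_alg M :=
  kappa *: tensor_op id (ep_lin ep i) + tensor_op (y_act i) (@id_linear L)
  + \sum_(k : 'I_n | k != i) tensor_op (perm_act (t i k)) (divided_difference_linear tr i k).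

Lemma mul_opE f g b : eval (mul_op f) (basis_tens g b) = basis_tens (f * g) b.
Proof. exact: tensor_opE. Qed.
Lemma perm_opE w g b : eval (perm_op w) (basis_tens g b) = basis_tens (sym w g) (perm_act w b).
Proof. exact: tensor_opE. Qed.
Lemma dunkl_opE i f b : eval (dunkl_op i) (basis_tens f b) =
  kappa *: basis_tens (d i f) b + basis_tens f (y_act i b)
  + \sum_(k : 'I_n | k != i) basis_tens (dd i k f) (perm_act (t i k) b).
Proof.
rewrite /dunkl_op !evalD evalZ eval_sum !tensor_opE; congr (_ + _).
by apply: eq_bigr => k _; rewrite tensor_opE.
Qed.

Lemma dunkl_op_one i b : eval (dunkl_op i) (basis_tens 1 b) = basis_tens 1 (y_act i b).
Proof.
rewrite dunkl_opE (ep_one ep) (lin0 (tl b)) scaler0 add0r big1 ?addr0 // => k _.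
by rewrite divided_difference_one (lin0 (tl _)).
Qed.

Lemma mul_op_alg_hom : @alg_hom F (pz_of L) (End_alg M) mul_op.
Proof.
split=> [c f g|].
  apply: tensor_op_ext => p b; rewrite evalD evalZ !mul_opE mulrDl -scalerAl.
  exact: tl.
split=> [|f g]; apply: tensor_op_ext => p b; first by rewrite mul_opE mul1r.
by rewrite evalM !mul_opE mulrA.
Qed.

Lemma perm_op_mul_op w f : perm_op w * mul_op f = mul_op (sym w f) * perm_op w.
Proof.
by apply: tensor_op_ext => p b; rewrite !evalM !(mul_opE, perm_opE) (tr_symM tr).
Qed.

Lemma induced_torus : perm_torus (mul_op \o x) (mul_op \o xV) perm_op.
Proof.
split=> [|u v|w i|i j|i|i] /=.
- by apply: tensor_op_ext => p b; rewrite perm_opE (tr_symid tr) perm_act1.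
- by apply: tensor_op_ext => p b; rewrite evalM !perm_opE perm_actM -(tr_comp tr).
- by rewrite perm_op_mul_op (tr_symX tr).
- by apply: tensor_op_ext => p b; rewrite !evalM !mul_opE mulrCA.
- by apply: tensor_op_ext => p b; rewrite evalM !mul_opE mulrA (tr_xV tr) mul1r.
- by apply: tensor_op_ext => p b; rewrite evalM !mul_opE mulrCA mulrA (tr_xV tr) mul1r.
Qed.

Lemma dunkl_op_x i j p b : eval (commutator (dunkl_op i) (mul_op (x j))) (basis_tens p b) =
  (kappa *+ (j == i)) *: basis_tens p b +
  \sum_(k : 'I_n | k != i) ((j == i)%:R - (j == k)%:R) *: eval (perm_op (t i k)) (basis_tens p b).
Proof.
rewrite /commutator evalD evalN !evalM mul_opE !dunkl_opE.
rewrite !(linD (eval_lin (mul_op (x j)))) (linZ (eval_lin _)) !mul_opE.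
rewrite (lin_sum (eval_lin _)) (ep_x ep) (linD (tl b)) scalerDr.
rewrite opprD [LHS]addrACA; congr (_ + _).
  rewrite opprD addrACA subrr addr0 addrAC subrr add0r.
  case: (j == i); rewrite ?mul1r ?mulr1n //.
  by rewrite mul0r (lin0 (tl b)) mulr0n scaler0 scale0r.
rewrite -sumrB; apply: eq_bigr => k ki; rewrite mul_opE perm_opE.
have ik : i != k by rewrite eq_sym.
rewrite divided_difference_x // (linD (tl _)) addrAC subrr add0r.
case: (j == i); case: (j == k); rewrite /= ?mulr1n ?mulr0n ?subrr ?subr0 ?sub0r ?mul1r ?scale1r //.
- by rewrite mul0r (lin0 (tl _)) scale0r.
- by rewrite mulNr mul1r scaleN1r (linN (tl _)).
- by rewrite mul0r (lin0 (tl _)) scale0r.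
Qed.

Lemma dunkl_op_rational : rational_rels (mul_op \o x) perm_op kappa dunkl_op.
Proof.
split=> [w i|i|i j ij]; apply: tensor_op_ext => p b.
- rewrite !evalM perm_opE !dunkl_opE !(linD (eval_lin (perm_op w))).
  rewrite (linZ (eval_lin _)) (lin_sum (eval_lin _)) !perm_opE (ep_sym ep) perm_act_y.
  congr (_ + _); rewrite [RHS](reindex_inj (@perm_inj _ w)) /=.
  apply: eq_big => [k|k _]; first by rewrite (inj_eq perm_inj).
  by rewrite perm_opE divided_difference_sym !perm_actM -tpermJ -conjgC.
- rewrite dunkl_op_x eqxx mulr1n evalD evalZ eval1 eval_sum; congr (_ + _).
  by apply: eq_bigr => k ki; rewrite eq_sym (negPf ki) subr0 scale1r.
- rewrite dunkl_op_x [j == i]eq_sym (negPf ij) mulr0n scale0r add0r evalN.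
  rewrite (bigD1 j) 1?eq_sym //= eqxx sub0r scaleN1r big1 ?addr0 // => k /andP[_ kj].
  by rewrite eq_sym (negPf kj) subrr scale0r.
Qed.

(** The commutator C commutes with multiplication by Laurent polynomials and
    kills every 1 (x) b, where the Dunkl operators reduce to the action on b. *)
Lemma dunkl_op_comm i j : commutator (dunkl_op i) (dunkl_op j) = 0.
Proof.
set C := commutator _ _.
have CX k : C * mul_op (x k) = mul_op (x k) * C.
  by apply/commutator0P; exact: (commYY_X i j k dunkl_op_rational).
have CV k : C * mul_op (xV k) = mul_op (xV k) * C.
  exact: (comm_inverse (pt_XK induced_torus k) (pt_VK induced_torus k) (CX k)).
have C1 b : eval C (basis_tens 1 b) = 0.
  by rewrite /C /commutator evalD evalN !evalM !dunkl_op_one y_actC subrr.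
clearbody C; have lC b : linear (fun p => eval C (basis_tens p b)).
  by move=> c p q; rewrite tl eval_lin.
have l0 : linear (fun _ : L => 0 : M) by move=> c p q; rewrite scaler0 addr0.
apply: tensor_op_ext => p b.
apply: (tr_gen tr (W := eq_sub (lC b) l0)) => /= [|i0 f Cf|i0 f Cf]; first exact: C1.
  by rewrite -mul_opE -evalM CX evalM Cf (lin0 (eval_lin _)).
by rewrite -mul_opE -evalM CV evalM Cf (lin0 (eval_lin _)).
Qed.
End Induced.

(** * The two algebras by generators and relations *)

Section Presentations.
Variables (F : fieldType) (n : nat) (kappa : F).
Local Notation t i j := (tperm (i : 'I_n) (j : 'I_n)).

Section Rational.
Local Notation H := (rca n kappa).

Lemma generates_rca : generates (fun h : H =>
  (exists i, h = rca_x kappa i) \/ (exists w, h = rca_s kappa w) \/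
  (exists i, h = rca_y kappa i)).
Proof.
have gen := generates_quot (R := @rca_rel F n kappa)
  (generates_free_prod
    (generates_smash (act := poly_action F n) (@generates_poly F n))
    (@generates_poly F n)).
move=> W W1 WG; apply: gen => // g a [_ [[q [[_ [i ->] ->]|[w ->]] ->]|[_ [i ->] ->]] ->] Wa.
- by apply: WG => //; left; exists i.
- by apply: WG => //; right; left; exists w.
- by apply: WG => //; right; right; exists i.
Qed.

Lemma rca_poly_alg_hom : @alg_hom F (pz_of (poly_alg F n)) H (@rca_poly F n kappa).
Proof.
exact: (alg_hom_comp (alg_hom_comp (smash_in_alg_hom (poly_action F n))
  (fp_inl_alg_hom _ _)) (rca_pi_alg_hom n kappa)).
Qed.

Definition rca_ypoly (p : poly_alg F n) : H := rca_pi kappa (rat_ypoly p).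

Lemma rca_ypoly_alg_hom : @alg_hom F (pz_of (poly_alg F n)) H rca_ypoly.
Proof. exact: (alg_hom_comp (fp_inr_alg_hom _ _) (rca_pi_alg_hom n kappa)). Qed.

Lemma rca_s1 : rca_s kappa (1%g : 'S_n) = 1.
Proof.
have [_ [p1 _]] := rca_pi_alg_hom n kappa.
have [_ [l1 _]] := fp_inl_alg_hom (rat_smash F n) (pz_of (poly_alg F n)).
by rewrite /rca_s /rat_s smash_perm1 l1 p1.
Qed.

Lemma rca_sM (u v : 'S_n) : rca_s kappa u * rca_s kappa v = rca_s kappa (v * u)%g.
Proof.
have [_ [_ pM]] := rca_pi_alg_hom n kappa.
have [_ [_ lM]] := fp_inl_alg_hom (rat_smash F n) (pz_of (poly_alg F n)).
by rewrite /rca_s -pM /rat_s -lM smash_permM.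
Qed.

Lemma rca_s_poly (w : 'S_n) p :
  rca_s kappa w * rca_poly kappa p = rca_poly kappa (msym w p) * rca_s kappa w.
Proof.
have [_ [_ pM]] := rca_pi_alg_hom n kappa.
have [_ [_ lM]] := fp_inl_alg_hom (rat_smash F n) (pz_of (poly_alg F n)).
by rewrite /rca_s /rca_poly -!pM /rat_s /rat_poly -!lM smash_perm_in.
Qed.

Lemma rca_rational : rational_rels (@rca_x F n kappa) (@rca_s F n kappa) kappa (@rca_y F n kappa).
Proof.
have [lp [p1 pM]] := rca_pi_alg_hom n kappa.
have pc a b := alg_homB_comm a b (rca_pi_alg_hom n kappa).
split=> [|i|i j ij].
- apply: (equivariant_of_simple rca_s1 rca_sM) => i i' j i'E.
  by rewrite /rca_s /rca_y -!pM; apply/rca_pi_rel/rca_sy.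
- rewrite /rca_x /rca_y -pc (rca_pi_rel (rca_yx kappa i)) (linD lp) (linZ lp) p1.
  by rewrite (lin_sum lp).
- by rewrite /rca_x /rca_y -pc (rca_pi_rel (rca_yx' kappa ij)) (linN lp).
Qed.

Lemma rca_lift (B : pzAlgebra F) (f : poly_alg F n -> B) (s : 'S_n -> B)
    (Y : 'I_n -> B) :
  @alg_hom F (pz_of (poly_alg F n)) B f -> s 1%g = 1 ->
  (forall u v, s u * s v = s (v * u)%g) ->
  (forall w p, s w * f p = f (msym w p) * s w) ->
  rational_rels (fun i => f 'X_i) s kappa Y ->
  (forall i j, commutator (Y i) (Y j) = 0) ->
  exists h : H -> B,
    [/\ alg_hom h, forall p, h (rca_poly kappa p) = f p,
        forall w, h (rca_s kappa w) = s w & forall i, h (rca_y kappa i) = Y i].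
Proof.
move=> homf s1 sM sf rr YC.
have [h1 [hom1 h1in h1s]] := smash_lift (act := poly_action F n) homf s1 sM sf.
have [|h2 [hom2 h2Y]] := @poly_lift F n B Y.
  by move=> i j; apply/commutator0P.
have [h3 [hom3 h3l h3r]] := free_prod_lift hom1 hom2.
have [l3 [h31 _]] := hom3.
have h3s w : h3 (rat_s F w) = s w by rewrite h3l h1s.
have h3y i : h3 (rat_ypoly 'X_i) = Y i by rewrite h3r h2Y.
have h3x i : h3 (rat_poly 'X_i) = f 'X_i by rewrite h3l h1in.
have hsy w i : h3 (rat_s F w * rat_ypoly 'X_i) = s w * Y i
  := alg_homME hom3 (h3s w) (h3y i).
have hys w i : h3 (rat_ypoly 'X_i * rat_s F w) = Y i * s w
  := alg_homME hom3 (h3y i) (h3s w).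
have hc i j : h3 (commutator (rat_ypoly 'X_i) (rat_poly 'X_j)) =
    commutator (Y i) (f 'X_j) := alg_hom_commE hom3 (h3y i) (h3x j).
have [|h [homh hE]] := quot_lift (R := @rca_rel F n kappa) hom3.
  move=> _ _ [i i' j i'E|i|i j ij].
  - rewrite hsy hys; exact: (rr_sY rr).
  - rewrite hc (linD l3) (linZ l3) (lin_sum l3) h31 (rr_eq rr).
    by congr (_ + _); apply: eq_bigr => k _; rewrite h3s.
  - rewrite hc (linN l3) h3s; exact: (rr_neq rr).
exists h; split=> // [p|w|i].
- by rewrite /rca_poly /rca_pi hE h3l h1in.
- by rewrite /rca_s /rca_pi hE.
- by rewrite /rca_y /rca_pi hE.
Qed.
End Rational.

Section Trigonometric.
Local Notation D := (ddaha n kappa).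

Definition ddaha_laurent (f : laurent_alg F n) : D := ddaha_pi kappa (trig_laurent f).

Lemma generates_ddaha : generates (fun h : D =>
  (exists i, h = ddaha_x kappa i) \/ (exists i, h = ddaha_xV kappa i) \/
  (exists w, h = ddaha_s kappa w) \/
  (exists i, h = ddaha_u kappa i)).
Proof.
have gen := generates_quot (R := @ddaha_rel F n kappa)
  (generates_free_prod
    (generates_smash (act := laurent_action F n) (@generates_laurent F n))
    (@generates_poly F n)).
move=> W W1 WG; apply: gen => // g a
  [_ [[q [[_ [[i ->]|[i ->]] ->]|[w ->]] ->]|[_ [i ->] ->]] ->] Wa.
- by apply: WG => //; left; exists i.
- by apply: WG => //; right; left; exists i.
- by apply: WG => //; right; right; left; exists w.
- by apply: WG => //; right; right; right; exists i.
Qed.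

Lemma ddaha_laurent_alg_hom :
  @alg_hom F (pz_of (laurent_alg F n)) D ddaha_laurent.
Proof.
exact: (alg_hom_comp (alg_hom_comp (smash_in_alg_hom (laurent_action F n))
  (fp_inl_alg_hom _ _)) (ddaha_pi_alg_hom n kappa)).
Qed.

Lemma ddaha_s1 : ddaha_s kappa (1%g : 'S_n) = 1.
Proof.
have [_ [p1 _]] := ddaha_pi_alg_hom n kappa.
have [_ [l1 _]] := fp_inl_alg_hom (trig_smash F n) (pz_of (poly_alg F n)).
by rewrite /ddaha_s /trig_s smash_perm1 l1 p1.
Qed.

Lemma ddaha_sM (u v : 'S_n) :
  ddaha_s kappa u * ddaha_s kappa v = ddaha_s kappa (v * u)%g.
Proof.
have [_ [_ pM]] := ddaha_pi_alg_hom n kappa.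
have [_ [_ lM]] := fp_inl_alg_hom (trig_smash F n) (pz_of (poly_alg F n)).
by rewrite /ddaha_s -pM /trig_s -lM smash_permM.
Qed.

Lemma ddaha_s_laurent (w : 'S_n) f :
  ddaha_s kappa w * ddaha_laurent f = ddaha_laurent (lsym w f) * ddaha_s kappa w.
Proof.
have [_ [_ pM]] := ddaha_pi_alg_hom n kappa.
have [_ [_ lM]] := fp_inl_alg_hom (trig_smash F n) (pz_of (poly_alg F n)).
by rewrite /ddaha_s /ddaha_laurent -!pM /trig_s /trig_laurent -!lM smash_perm_in.
Qed.

Lemma ddaha_torus :
  perm_torus (@ddaha_x F n kappa) (@ddaha_xV F n kappa) (@ddaha_s F n kappa).
Proof.
have hom := ddaha_laurent_alg_hom.
split=> [|u v|w i|i j|i|i].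
- exact: ddaha_s1.
- exact: ddaha_sM.
- by rewrite [LHS]ddaha_s_laurent lsym_lX.
- exact: (alg_homM_com hom (mulrC (lX F i) (lX F j))).
- exact: (alg_homM_inv hom (lX_lXV F i)).
- exact: (alg_homM_inv hom (etrans (mulrC _ _) (lX_lXV F i))).
Qed.

Lemma ddaha_trig :
  trig_rels (@ddaha_x F n kappa) (@ddaha_s F n kappa) kappa (@ddaha_u F n kappa).
Proof.
have [lp [p1 pM]] := ddaha_pi_alg_hom n kappa.
have pc a b := alg_homB_comm a b (ddaha_pi_alg_hom n kappa).
split=> [i i' i'E|i i' i'E|i i' j i'E ji ji'|i|i j ji|i j ij].
- by rewrite /ddaha_s /ddaha_u -!pM (ddaha_pi_rel (ddaha_su kappa i'E)) (linB lp) p1.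
- by rewrite /ddaha_s /ddaha_u -!pM (ddaha_pi_rel (ddaha_su' kappa i'E)) (linD lp) p1.
- by rewrite /ddaha_s /ddaha_u -!pM; apply/ddaha_pi_rel/ddaha_suj.
- rewrite /ddaha_u /ddaha_x -pc (ddaha_pi_rel (ddaha_ux kappa i)) !(linD lp) (linZ lp).
  rewrite !(lin_sum lp); congr (_ + _ + _); apply: eq_bigr => k _; exact: pM.
- by rewrite /ddaha_u /ddaha_x -pc (ddaha_pi_rel (ddaha_ux_gt kappa ji)) (linN lp) pM.
- by rewrite /ddaha_u /ddaha_x -pc (ddaha_pi_rel (ddaha_ux_lt kappa ij)) (linN lp) pM.
Qed.

Lemma ddaha_u_comm i j : commutator (ddaha_u kappa i) (ddaha_u kappa j) = 0 :> D.
Proof.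
have hom : @alg_hom F (pz_of (poly_alg F n)) D (ddaha_pi kappa \o @trig_upoly F n).
  exact: (alg_hom_comp (fp_inr_alg_hom _ _) (ddaha_pi_alg_hom n kappa)).
apply/commutator0P; exact: (alg_homM_com hom (mulrC ('X_i : mpoly n F) 'X_j)).
Qed.

Lemma ddaha_lift (B : pzAlgebra F) (f : laurent_alg F n -> B) (s : 'S_n -> B)
    (U : 'I_n -> B) :
  @alg_hom F (pz_of (laurent_alg F n)) B f -> s 1%g = 1 ->
  (forall u v, s u * s v = s (v * u)%g) ->
  (forall w p, s w * f p = f (lsym w p) * s w) ->
  trig_rels (fun i => f (lX F i)) s kappa U ->
  (forall i j, commutator (U i) (U j) = 0) ->
  exists h : D -> B,
    [/\ alg_hom h, forall p, h (ddaha_laurent p) = f p,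
        forall w, h (ddaha_s kappa w) = s w & forall i, h (ddaha_u kappa i) = U i].
Proof.
move=> homf s1 sM sf rr UC.
have [h1 [hom1 h1in h1s]] := smash_lift (act := laurent_action F n) homf s1 sM sf.
have [|h2 [hom2 h2U]] := @poly_lift F n B U.
  by move=> i j; apply/commutator0P.
have [h3 [hom3 h3l h3r]] := free_prod_lift hom1 hom2.
have [l3 [h31 _]] := hom3.
have h3s w : h3 (trig_s F w) = s w by rewrite h3l h1s.
have h3u i : h3 (trig_upoly 'X_i) = U i by rewrite h3r h2U.
have h3x i : h3 (trig_laurent (lX F i)) = f (lX F i) by rewrite h3l h1in.
have hsu w i : h3 (trig_s F w * trig_upoly 'X_i) = s w * U i
  := alg_homME hom3 (h3s w) (h3u i).
have hus w i : h3 (trig_upoly 'X_i * trig_s F w) = U i * s w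
  := alg_homME hom3 (h3u i) (h3s w).
have hxs w i : h3 (trig_laurent (lX F i) * trig_s F w) = f (lX F i) * s w
  := alg_homME hom3 (h3x i) (h3s w).
have hc i j : h3 (commutator (trig_upoly 'X_i) (trig_laurent (lX F j))) =
    commutator (U i) (f (lX F j)) := alg_hom_commE hom3 (h3u i) (h3x j).
have [|h [homh hE]] := quot_lift (R := @ddaha_rel F n kappa) hom3.
  move=> _ _ [i i' i'E|i i' i'E|i i' j i'E ji ji'|i|i j ji|i j ij].
  - by rewrite hsu (linB l3) hus h31 (tr_su rr).
  - by rewrite hsu (linD l3) hus h31 (tr_su' rr).
  - by rewrite hsu hus (tr_suj rr).
  - rewrite hc !(linD l3) (linZ l3) !(lin_sum l3) h3x (tr_eq rr).
    by congr (_ + _ + _); apply: eq_bigr => k _; rewrite hxs.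
  - by rewrite hc (linN l3) hxs (tr_gt rr).
  - by rewrite hc (linN l3) hxs (tr_lt rr).
exists h; split=> // [p|w|i].
- by rewrite /ddaha_laurent /ddaha_pi hE h3l h1in.
- by rewrite /ddaha_s /ddaha_pi hE.
- by rewrite /ddaha_u /ddaha_pi hE.
Qed.
End Trigonometric.
End Presentations.

(** * Commutators landing in the smash product *)

Section SmashSpan.
Variables (F : fieldType) (n : nat) (C : algType F) (act : 'S_n -> C -> C).
Variables (A : pzAlgebra F) (l : C -> A) (s : 'S_n -> A).
Hypothesis homl : @alg_hom F (pz_of C) A l.
Hypothesis s1 : s 1%g = 1.
Hypothesis sM : forall u v, s u * s v = s (v * u)%g.
Hypothesis sl : forall w f, s w * l f = l (act w f) * s w.

(** The image of the smash product of C with S_n. *)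
Definition smash_span : submodule A :=
  span_of (fun a : A => exists f w, a = l f * s w).

Lemma smash_span_term f w : smash_span (l f * s w).
Proof. by apply: in_span_gen; exists f, w. Qed.

Lemma smash_span_s w : smash_span (s w).
Proof. by have [_ [l1 _]] := homl; rewrite -[s w]mul1r -l1; apply: smash_span_term. Qed.

Lemma smash_span_ll f a : smash_span a -> smash_span (l f * a).
Proof.
have [_ [_ lM]] := homl.
apply: (in_spanP (W := preim_sub (linear_mull (l f)) smash_span)).
move=> _ [g [w ->]] /=; rewrite mulrA -[l f * l g](lM f g); exact: smash_span_term.
Qed.

Lemma smash_span_lr f a : smash_span a -> smash_span (a * l f).
Proof.
have [_ [_ lM]] := homl.
apply: (in_spanP (W := preim_sub (linear_mulr (l f)) smash_span)).
move=> _ [g [w ->]] /=; rewrite -mulrA sl mulrA -[l g * l _](lM g _).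
exact: smash_span_term.
Qed.

Lemma commutator_linear (y : A) : linear (fun a : A => commutator y a).
Proof.
move=> c a b; rewrite /commutator mulrDr mulrDl -pzscalerAl -pzscalerAr opprD addrACA.
by rewrite scalerBr.
Qed.

Lemma commutator_smash_span (y : A) (G : pz_of C -> Prop) :
  generates G -> (forall g, G g -> smash_span (commutator y (l g))) ->
  forall f, smash_span (commutator y (l f)).
Proof.
move=> genG yG; have [ll [l1 lM]] := homl.
have lc : linear (fun f : pz_of C => commutator y (l f)).
  by move=> c f g; rewrite ll (commutator_linear y).
apply: (genG (preim_sub lc smash_span)) => /= [|g a Gg ya].
  by rewrite l1 /commutator mulr1 mul1r subrr; exact: (sub_mem0 smash_span).
rewrite (lM g a) commutatorMr.
exact: (sub_memD (smash_span_lr a (yG g Gg)) (smash_span_ll g ya)).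
Qed.

(** From [y, g] = - g [y, f] g when g is the inverse of f. *)
Lemma smash_span_inverse (y : A) f g : f * g = 1 -> g * f = 1 ->
  smash_span (commutator y (l f)) -> smash_span (commutator y (l g)).
Proof.
move=> fg gf yf; have fgA := alg_homM_inv homl fg; have gfA := alg_homM_inv homl gf.
have -> : commutator y (l g) = - (l g * commutator y (l f) * l g).
  rewrite /commutator mulrBr mulrBl !mulrA gfA mul1r -!mulrA fgA mulr1.
  by rewrite opprB.
exact: (sub_memN (smash_span_lr g (smash_span_ll g yf))).
Qed.
End SmashSpan.

(** * The homomorphism iota *)

Section Embedding.
Variables (F : fieldType) (n : nat) (kappa : F).
Local Notation H := (rca n kappa).
Local Notation D := (ddaha n kappa).
Local Notation L := (laurent F n).
Local Notation ddl := (@ddaha_laurent F n kappa).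

Lemma mnm_ind (P : 'X_{1..n} -> Prop) :
  P 0%MM -> (forall i m, P m -> P (U_(i) + m)%MM) -> forall m, P m.
Proof.
move=> P0 PS m; have [k] := ubnP (mdeg m); elim: k m => // k IHk m.
have [->//|m0] := eqVneq m 0%MM.
have [i mi] : exists i, m i != 0%N.
  apply/existsP; apply: contraNT m0; rewrite negb_exists => /forallP m0.
  by apply/eqP/mnmP => i; rewrite mnm0E; apply/eqP; have := m0 i; rewrite negbK.
have -> : m = (U_(i) + (m - U_(i)))%MM.
  rewrite addmC submK //; apply/mnm_lepP => j; rewrite mnm1E.
  by case: (i =P j) => [<-|//]; rewrite lt0n.
rewrite mdegD mdeg1 => lt_mk; apply: PS; apply: IHk; exact: lt_mk.
Qed.

Lemma laurent_of_poly_alg_hom :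
  @alg_hom F (pz_of (poly_alg F n)) (pz_of (laurent_alg F n)) (@laurent_of_poly F n).
Proof.
rewrite /laurent_of_poly; split; last first.
  split=> [|p q]; [exact: (rmorph1 (mpoly.mmap (in_alg L) (@lX F n)))|
                   exact: (rmorphM (mpoly.mmap (in_alg L) (@lX F n)))].
move=> c p q; rewrite [LHS](raddfD (mpoly.mmap (in_alg L) (@lX F n))); congr (_ + _).
by rewrite [LHS](mpoly.mmapZ (@lX F n) (in_alg L) c p) /= -scalerAl mul1r.
Qed.

Lemma laurent_of_polyX i : laurent_of_poly ('X_i : mpoly n F) = lX F i.
Proof. by rewrite /laurent_of_poly mpoly.mmapX mmap1U. Qed.

Lemma lsym_of_poly w p :
  lsym w (laurent_of_poly p) = laurent_of_poly (msym w p) :> laurent_alg F n.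
Proof.
have h1 := alg_hom_comp laurent_of_poly_alg_hom (lsym_alg_hom F w).
have h2 := alg_hom_comp (msym_alg_hom F w) laurent_of_poly_alg_hom.
apply: (alg_hom_ext (@generates_poly F n) h1 h2) => _ [i ->] /=.
by rewrite msym_mpolyX !laurent_of_polyX lsym_lX.
Qed.

Definition exponent (m : 'X_{1..n}) : {ffun 'I_n -> int} := [ffun i => (m i)%:Z].

Lemma exponent_inj : injective exponent.
Proof.
by move=> a b /ffunP ab; apply/mnmP => i; have := ab i; rewrite !ffunE => -[].
Qed.

Lemma laurent_of_polyXm m : laurent_of_poly ('X_[m] : mpoly n F) = lmon F (exponent m).
Proof.
have [_ [l1 lM]] := laurent_of_poly_alg_hom.
elim/mnm_ind: m => [|i m IHm].
  rewrite mpolyX0 [LHS]l1 -[LHS]/(lmon F 0); congr lmon.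
  by apply/ffunP => i; rewrite !ffunE mnm0E.
rewrite mpolyXD [LHS]lM IHm laurent_of_polyX.
have -> : exponent (U_(i) + m) = expo1 i + exponent m.
  by apply/ffunP => j; rewrite !ffunE mnmDE mnm1E eq_sym PoszD; case: (j == i).
by apply/esym/lmonD.
Qed.

(** The last clause records iota on all of F[x]; it is what makes
    f (x) h |-> f iota(h) balanced over F[x]. *)
Lemma exists_iota : exists iota : H -> D,
  [/\ alg_hom iota, iota_spec iota
    & forall p, iota (rca_poly kappa p) = ddl (laurent_of_poly p)].
Proof.
have pt := @ddaha_torus F n kappa.
have rr := rational_of_trig pt (@ddaha_trig F n kappa).
have homf := alg_hom_comp laurent_of_poly_alg_hom (@ddaha_laurent_alg_hom F n kappa).
have fX : (fun i => (ddl \o @laurent_of_poly F n) 'X_i) = @ddaha_x F n kappa.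
  by apply: funext => i /=; rewrite laurent_of_polyX.
have [w p|||h [homh hp hs hy]] :=
  rca_lift (kappa := kappa) homf (@ddaha_s1 F n kappa) (@ddaha_sM F n kappa)
  (Y := fun i => ddaha_xV kappa i * (ddaha_u kappa i - murphy (@ddaha_s F n kappa) i)).
- by rewrite /= ddaha_s_laurent lsym_of_poly.
- by rewrite fX.
- exact: (rational_comm_of_trig pt (@ddaha_trig F n kappa) (@ddaha_u_comm F n kappa)).
exists h; split; [exact: homh | split; [exact: hs | | exact: hy] | exact: hp].
by move=> i; rewrite [LHS]hp /= laurent_of_polyX.
Qed.
End Embedding.

(** * The trigonometric algebra acts on the induced module *)

Section LaurentInduced.
Variables (F : fieldType) (n : nat) (kappa : F).
Local Notation L := (laurent F n).
Local Notation E := {ffun 'I_n -> int}.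

Lemma laurent_partials : equivariant_partials (@lX F n) (@lsym F n) (@laurent_deriv F n).
Proof.
split; [exact: laurent_deriv_linear | exact: laurent_deriv_one
      | exact: laurent_deriv_lX | exact: laurent_deriv_sym].
Qed.

(** The basis x^e (x) b is taken over F rather than over the Laurent ring,
    since the operators are not linear over the latter. *)
Definition induced : lmodType F := {malg F[(E * ymon_perm n)%type]}.
Definition basis_tens (f : L) (b : ymon_perm n) : induced :=
  mlin (fun e : E => << (e, b) >> : induced) f.

Lemma basis_tens_mon e b : basis_tens (lmon F e) b = << (e, b) >>.
Proof. exact: mlinU. Qed.

Lemma induced_free : free_over basis_tens.
Proof.
have tl b : linear (basis_tens^~ b) by exact: mlin_linear.
split=> // [f g lf lg fg|a beta la].
  by apply: malg_ext => // [[e b]]; rewrite -basis_tens_mon fg.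
have lop : linear (mlin (fun k : (E * ymon_perm n)%type => basis_tens (a (lmon F k.1)) (beta k.2)) :
    induced -> induced) by exact: mlin_linear.
exists (Endo lop : End_alg induced) => p b; rewrite /eval /=.
apply: (laurent_linear_ext (f := fun p => mlin _ (basis_tens p b))
         (g := fun p => basis_tens (a p) (beta b))) => [c g h|c g h|e].
- by rewrite tl lop.
- by rewrite la tl.
by rewrite basis_tens_mon mlinU.
Qed.

Let tr := @laurent_torus_ring F n.
Let ep := laurent_partials.
Let fo := induced_free.

(** The elements in the last clause are the values of iota on the y_i. *)
Lemma exists_rep : exists rho : ddaha n kappa -> End_alg induced,
  [/\ alg_hom rho,
      forall f, rho (ddaha_laurent kappa f) = mul_op fo f,
      forall w, rho (ddaha_s kappa w) = perm_op tr fo w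
    & forall i, rho (ddaha_xV kappa i *
          (ddaha_u kappa i - \sum_(j : 'I_n | (j < i)%N) ddaha_s kappa (tperm j i))) =
        dunkl_op kappa tr ep fo i].
Proof.
have pt := induced_torus tr fo.
have rr := dunkl_op_rational kappa tr ep fo.
have UC := (trig_comm_iff pt rr).1 (dunkl_op_comm kappa tr ep fo).
have [rho [homr rl rs ru]] := ddaha_lift (mul_op_alg_hom fo) (pt_s1 pt) (pt_sM pt)
  (perm_op_mul_op tr fo) (trig_of_rational pt rr) UC.
exists rho; split; [exact: homr | exact: rl | exact: rs | move=> i].
have [lr [_ rM]] := homr.
rewrite rM (linB lr) (lin_sum lr) ru.
have -> : \sum_(j < n | (j < i)%N) rho (ddaha_s kappa (tperm j i)) =
    murphy (perm_op tr fo) i by apply: eq_bigr => j _.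
rewrite addrK -[ddaha_xV _ i]/(ddaha_laurent kappa (lXV F i)) rl mulrA.
by rewrite (pt_VK pt) mul1r.
Qed.
End LaurentInduced.

(** * Normally ordered monomials span the rational algebra *)

Section TriangularSpan.
Variables (F : fieldType) (n : nat) (C : algType F) (act : 'S_n -> C -> C).
Variables (g : 'I_n -> C) (A : pzAlgebra F) (X Y : C -> A) (s : 'S_n -> A).
Hypothesis genC : generates (fun p : pz_of C => exists i, p = g i).
Hypothesis hom_act : forall w, @alg_hom F (pz_of C) (pz_of C) (act w).
Hypothesis act_g : forall w i, act w (g i) = g (w i).
Hypothesis homX : @alg_hom F (pz_of C) A X.
Hypothesis homY : @alg_hom F (pz_of C) A Y.
Hypothesis s1 : s 1%g = 1.
Hypothesis sM : forall u v, s u * s v = s (v * u)%g.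
Hypothesis sX : forall w f, s w * X f = X (act w f) * s w.
Hypothesis sYg : forall w i, s w * Y (g i) = Y (g (w i)) * s w.
Local Notation J := (smash_span X s).
Hypothesis YgX : forall i j, J (commutator (Y (g i)) (X (g j))).
Hypothesis genA : generates (fun a : A => (exists i, a = X (g i)) \/
  (exists w, a = s w) \/ (exists i, a = Y (g i))).

Lemma equivariant_gen w p : s w * Y p = Y (act w p) * s w.
Proof.
have [lY [Y1 YM]] := homY; have [lm [m1 mM]] := hom_act w.
have l1 : linear (fun p : pz_of C => s w * Y p).
  by move=> c u v; rewrite lY linear_mull.
have l2 : linear (fun p : pz_of C => Y (act w p) * s w).
  by move=> c u v; rewrite lm lY linear_mulr.
suff genW : forall q : pz_of C, eq_sub l1 l2 q by exact: (genW p).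
apply: genC => /= [|_ q [i ->] IH].
  by rewrite m1 Y1 mulr1 mul1r.
rewrite (mM (g i) q) (YM (g i) q) (YM (act w (g i)) _) act_g mulrA.
by rewrite sYg -!mulrA IH.
Qed.

(** The span of the X f Y p w is stable under left multiplication by the
    generators.  For X and w this is immediate; and
    y X f = X f y + [y, X f], where the commutator involves no Y. *)
Lemma triangular_span (a : A) :
  span_of (fun a : A => exists f p w, a = X f * (Y p * s w)) a.
Proof.
set K := span_of _.
have KX f p w : K (X f * (Y p * s w)) by apply: in_span_gen; exists f, p, w.
have [_ [X1 XM]] := homX; have [_ [Y1 YM]] := homY.
have Kl f b : K b -> K (X f * b).
  apply: (in_spanP (W := preim_sub (linear_mull (X f)) K)) => _ [f' [p [w ->]]] /=.
  rewrite mulrA -[X f * X f'](XM f f'); exact: KX.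
have Ks v b : K b -> K (s v * b).
  apply: (in_spanP (W := preim_sub (linear_mull (s v)) K)) => _ [f [p [w ->]]] /=.
  rewrite mulrA sX -mulrA [s v * _]mulrA equivariant_gen -mulrA sM; exact: KX.
have KJ j b : J j -> K b -> K (j * b).
  move=> Jj Kb; apply: (in_spanP (W := preim_sub (linear_mulr b) K) _ Jj).
  move=> _ [f [w ->]] /=; rewrite -mulrA; exact: (Kl f _ (Ks w b Kb)).
have JX i f : J (commutator (Y (g i)) (X f)).
  by apply: (commutator_smash_span homX sX genC) => _ [j ->].
have Ky i b : K b -> K (Y (g i) * b).
  apply: (in_spanP (W := preim_sub (linear_mull (Y (g i))) K)) => _ [f [p [w ->]]] /=.
  have -> : Y (g i) * (X f * (Y p * s w)) = commutator (Y (g i)) (X f) * (Y p * s w)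
      + X f * (Y (g i) * (Y p * s w)).
    by rewrite /commutator mulrBl -!mulrA subrK.
  have KYs q : K (Y q * s w) by rewrite -[Y q * s w]mul1r -X1.
  have := Kl f _ (KYs (g i * p)); rewrite [Y _](YM (g i) p) -mulrA.
  exact: (sub_memD (KJ _ _ (JX i f) (KYs p))).
apply: genA => [|_ b [[i ->]|[[w ->]|[i ->]]] Kb].
- by have := KX 1 1 1%g; rewrite X1 Y1 s1 !mulr1.
- exact: Kl.
- exact: Ks.
- exact: Ky.
Qed.
End TriangularSpan.

(** * Injectivity of iota *)

Section PBW.
Variables (F : fieldType) (n : nat) (kappa : F).
Local Notation H := (rca n kappa).
Local Notation X f := (rca_poly kappa f).
Local Notation Y p := (rca_ypoly kappa p).
Local Notation s w := (rca_s kappa w).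
Local Notation P := (mpoly n F).

Local Notation J := (smash_span (@rca_poly F n kappa) (@rca_s F n kappa)).
Let homX := @rca_poly_alg_hom F n kappa.
Let s1 := @rca_s1 F n kappa.
Let sM := @rca_sM F n kappa.
Let sX := @rca_s_poly F n kappa.

Lemma commutator_rca_yx i j : J (commutator (rca_y kappa i) (rca_x kappa j)).
Proof.
have Js w : J (s w) := smash_span_s (@rca_s F n kappa) homX w.
have J1 : J 1 by rewrite -s1; exact: Js.
have [<-|ij] := eqVneq i j.
  rewrite (rr_eq (@rca_rational F n kappa)).
  apply: (sub_memZD kappa (v := \sum_(k < n | k != i) s (tperm i k)) J1).
  by apply: sub_mem_sum => k _; exact: Js.
rewrite (rr_neq (@rca_rational F n kappa)) //; exact: (sub_memN (Js (tperm i j))).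
Qed.

Lemma rca_pbw_span : forall h : H,
  span_of (fun a : H => exists f p w, a = X f * (Y p * s w)) h.
Proof.
exact: (triangular_span (@generates_poly F n) (@msym_alg_hom F n) (@msym_mpolyX F n)
  homX (@rca_ypoly_alg_hom F n kappa) s1 sM sX (rr_sY (@rca_rational F n kappa))
  commutator_rca_yx (@generates_rca F n kappa)).
Qed.

Definition pbw_index : Type := ('X_{1..n} * ('X_{1..n} * 'S_n))%type.
HB.instance Definition _ := Choice.on pbw_index.
Definition pbw (k : pbw_index) : H := X 'X_[k.1] * (Y 'X_[k.2.1] * s k.2.2).

Lemma pbw_spanning (h : H) : exists g : {malg F[pbw_index]}, mlin pbw g = h.
Proof.
have lg : linear (mlin pbw : {malg F[pbw_index]} -> H) by exact: mlin_linear.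
have [lX _] := homX; have [lY _] := @rca_ypoly_alg_hom F n kappa.
apply: (in_spanP (W := range_sub lg) _ (rca_pbw_span h)) => _ [f [p [w ->]]] /=.
have l1 : linear (fun f => X f * (Y p * s w)) by move=> c u v; rewrite lX linear_mulr.
apply: (mpoly_span (W := preim_sub l1 (range_sub lg))) => a /=.
have l2 : linear (fun p => X 'X_[a] * (Y p * s w)).
  by move=> c u v; rewrite lY linear_mulr linear_mull.
apply: (mpoly_span (W := preim_sub l2 (range_sub lg))) => b /=.
by exists << (a, (b, w)) : pbw_index >>; rewrite mlinU.
Qed.

Variable iota : H -> ddaha n kappa.
Hypothesis homi : alg_hom iota.
Hypothesis ispec : iota_spec iota.
Hypothesis iX : forall p, iota (X p) = ddaha_laurent kappa (laurent_of_poly p).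

(** The vector 1 (x) 1 separates the elements of the image: x^a y^b w sends it
    to the basis vector x^a (x) y^b w. *)
Lemma iota_injective : injective iota.
Proof.
have [rho [homr rl rs ry]] := exists_rep n kappa.
have hom := alg_hom_comp homi homr; have [lri [ri1 riM]] := hom.
have [is_ ix iy] := ispec.
set fo := induced_free F n in rl rs ry.
have actX m b p : eval ((rho \o iota) (X 'X_[m])) (basis_tens p b) =
    basis_tens (lmon F (exponent m) * p) b.
  by rewrite /= iX rl laurent_of_polyXm mul_opE.
have acts w : eval ((rho \o iota) (s w)) (basis_tens 1 (0%MM, 1%g)) =
    basis_tens (1 : laurent F n) (0%MM, w).
  rewrite /= is_ rs perm_opE; congr basis_tens; first exact: (lsym_alg_hom F w).2.1.
  by congr (_, _); rewrite /= ?mul1g //; apply/mnmP => i; rewrite mnmE !mnm0E.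
have acty i b : eval ((rho \o iota) (rca_y kappa i)) (basis_tens 1 b) =
    basis_tens (1 : laurent F n) (y_act i b).
  by rewrite /= iy ry dunkl_op_one.
have [_ [Y1 YM]] := @rca_ypoly_alg_hom F n kappa.
have actY m w : eval ((rho \o iota) (Y 'X_[m])) (basis_tens 1 (0%MM, w)) =
    basis_tens (1 : laurent F n) (m, w).
  elim/mnm_ind: m => [|i m IHm]; first by rewrite mpolyX0 [Y 1]Y1 ri1.
  have YE : Y 'X_[U_(i) + m] = rca_y kappa i * Y 'X_[m].
    by rewrite mpolyXD; exact: (YM 'X_i 'X_[m]).
  by rewrite YE (riM (rca_y kappa i)) evalM IHm; exact: (acty i (m, w)).
pose key (k : pbw_index) : ({ffun 'I_n -> int} * ymon_perm n)%type := (exponent k.1, k.2).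
have key_inj : injective key.
  move=> [a b] [a' b'] e; congr (_, _).
    exact: exponent_inj (congr1 fst e).
  exact: (congr1 snd e).
have act_pbw k : eval ((rho \o iota) (pbw k)) (basis_tens 1 (0%MM, 1%g)) = << key k >>.
  case: k => a [b w]; rewrite /pbw riM evalM riM evalM acts actY actX mulr1.
  exact: basis_tens_mon.
have li := homi.1.
suff ker0 h : iota h = 0 -> h = 0.
  move=> h h' hh'; apply/eqP; rewrite -subr_eq0; apply/eqP/ker0.
  by rewrite (linB li) hh' subrr.
have [g <-] := pbw_spanning h => ig0.
(* hence the action of any combination has the same coefficients *)
have act_g : forall g, eval ((rho \o iota) (mlin pbw g)) (basis_tens 1 (0%MM, 1%g)) =
    mlin (fun k => << key k >> : induced F n) g.
  apply: malg_ext => [c u v|c u v|k].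
  - by rewrite (mlin_linear pbw) lri.
  - exact: mlin_linear.
  by rewrite !mlinU act_pbw.
have g0 : mlin (fun k => << key k >> : induced F n) g = 0.
  by rewrite -act_g /= ig0 (lin0 homr.1).
suff -> : g = 0 by exact: (lin0 (mlin_linear pbw)).
apply/malgP => k; rewrite monalg.mcoeff0.
have coefE : forall g : {malg F[pbw_index]},
    monalg.mcoeff (key k) (mlin (fun k => << key k >> : induced F n) g) =
    monalg.mcoeff k g :> F^o.
  apply: malg_ext => [c u v|c u v|k'].
  - by rewrite mlin_linear monalg.mcoeffD monalg.mcoeffZ.
  - by rewrite monalg.mcoeffD monalg.mcoeffZ.
  by rewrite mlinU !monalg.mcoeffU (inj_eq key_inj).
by rewrite -coefE g0 monalg.mcoeff0.
Qed.
End PBW.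

(** * Localization *)

Section Transport.
Variable F : fieldType.

Lemma eq_alg_hom (A B : pzAlgebra F) (f g : A -> B) :
  f =1 g -> alg_hom f -> alg_hom g.
Proof. by move=> /funext <-. Qed.

Lemma inverse_alg_hom (A B : pzAlgebra F) (f : A -> B) (g : B -> A) :
  alg_hom f -> cancel f g -> cancel g f -> alg_hom g.
Proof.
move=> [lf [f1 fM]] fK gK; have inj := can_inj fK.
split=> [c a b|]; first by apply: inj; rewrite lf !gK.
by split=> [|a b]; apply: inj; rewrite ?fM ?f1 !gK.
Qed.

Lemma transport_structure (V : lmodType F) (B : pzAlgebra F) (f : V -> B) (g : B -> V) :
  linear f -> cancel f g -> cancel g f ->
  exists S : alg_structure V, @alg_hom F (PzAlgebra S) B f.
Proof.
move=> lf fK gK; have inj := can_inj fK.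
have lg : linear g by move=> c a b; apply: inj; rewrite lf !gK.
pose mul u v := g (f u * f v).
have mulA : associative mul by move=> u v w; rewrite /mul !gK mulrA.
have mul1 : left_id (g 1) mul by move=> u; rewrite /mul gK mul1r fK.
have mul1' : right_id (g 1) mul by move=> u; rewrite /mul gK mulr1 fK.
have mulDl v : linear (mul^~ v).
  by move=> c u w; rewrite /mul lf (linear_mulr (f v)) lg.
have mulDr v : linear (mul v).
  by move=> c u w; rewrite /mul lf (linear_mull (f v)) lg.
exists (AlgStructure mulA mul1 mul1' mulDl mulDr).
split; [exact: lf | split=> [|u v]; exact: gK].
Qed.

Lemma lquot_lift (V V' : lmodType F) (W : submodule V) (f : V -> V') :
  linear f -> (forall v, W v -> f v = 0) ->
  exists f' : lquot W -> V', linear f' /\ forall v, f' (qpi W v) = f v.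
Proof.
move=> lf fW; pose f' (q : lquot W) := f (generic_quotient.repr q).
have f'E v : f' (qpi W v) = f v.
  by apply/eqP; rewrite -subr_eq0 -(linB lf); apply/eqP/fW/qpi_repr.
exists f'; split=> // c; elim/qpi_ind=> u; elim/qpi_ind=> v.
by rewrite -qpi_linear !f'E lf.
Qed.
End Transport.

Section TensorFacts.
Variables (F : fieldType) (P : Type) (L H : pzAlgebra F) (a : P -> L) (b : P -> H).
Local Notation tens := (tens a b).

Lemma tens_rel u : tensor_relator a b u -> qpi (span_of (tensor_relator a b)) u = 0.
Proof. by move=> ru; apply/qpiP; rewrite subr0; apply: in_span_gen. Qed.

Let lq := qpi_linear (span_of (tensor_relator a b)).

Lemma tensDl f f' h : tens (f + f') h = tens f h + tens f' h.
Proof.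
have := tens_rel (tr_addl a b f f' h); rewrite (linB lq) (linD lq) => /eqP.
by rewrite subr_eq0 => /eqP.
Qed.
Lemma tensDr f h h' : tens f (h + h') = tens f h + tens f h'.
Proof.
have := tens_rel (tr_addr a b f h h'); rewrite (linB lq) (linD lq) => /eqP.
by rewrite subr_eq0 => /eqP.
Qed.
Lemma tensZl c f h : tens (c *: f) h = c *: tens f h.
Proof.
have := tens_rel (tr_scale a b c f h); rewrite (linB lq) (linZ lq) => /eqP.
by rewrite subr_eq0 => /eqP.
Qed.
Lemma tens_balanced f p h : tens (f * a p) h = tens f (b p * h).
Proof.
have := tens_rel (tr_balanced a b f p h); rewrite (linB lq) => /eqP.
by rewrite subr_eq0 => /eqP.
Qed.
Lemma tens_linear h : linear (tens^~ h).
Proof. by move=> c f g; rewrite tensDl tensZl. Qed.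
Lemma tens_span (W : submodule (tensor a b)) :
  (forall f h, W (tens f h)) -> forall t, W t.
Proof.
move=> Wt; elim/qpi_ind=> u; rewrite [u]monalgE (lin_sum lq).
apply: sub_mem_sum => -[f h] _; rewrite mkmalgU_scale (linZ lq).
exact: (sub_memZ _ (Wt f h)).
Qed.

Lemma tensor_lift (V : lmodType F) (m : L -> H -> V) :
  (forall h, linear (m^~ h)) -> (forall f, {morph m f : h h' / h + h'}) ->
  (forall f p h, m (f * a p) h = m f (b p * h)) ->
  exists phi : tensor a b -> V, linear phi /\ forall f h, phi (tens f h) = m f h.
Proof.
move=> ml mr mb; pose m' (k : (L * H)%type) := m k.1 k.2.
have lm : linear (mlin m') by exact: mlin_linear.
have [|phi [lphi phiE]] := lquot_lift (W := span_of (tensor_relator a b)) lm.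
  move=> v; elim=> {v} [v [f f' h|f h h'|c f h|f p h]||c u v _ mu _ mv].
  - by rewrite (linB lm) (linD lm) !mlinU /m' /= (linD (ml h)) subrr.
  - by rewrite (linB lm) (linD lm) !mlinU /m' /= mr subrr.
  - by rewrite (linB lm) (linZ lm) !mlinU /m' /= (linZ (ml h)) subrr.
  - by rewrite (linB lm) !mlinU /m' /= mb subrr.
  - exact: (lin0 lm).
  - by rewrite lm mu mv scaler0 addr0.
by exists phi; split=> // f h; rewrite phiE mlinU.
Qed.
End TensorFacts.

(** Tensors are F-linear on the right through the scalars of P, which are
    moved to the left by balancedness. *)
Lemma tensZr (F : fieldType) (P L H : pzAlgebra F) (a : P -> L) (b : P -> H) c f h :
  alg_hom a -> alg_hom b -> tens a b f (c *: h) = c *: tens a b f h.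
Proof.
move=> [la [a1 _]] [lb [b1 _]].
have -> : c *: h = b (c *: (1 : P)) * h by rewrite (linZ lb) b1 -pzscalerAl mul1r.
by rewrite -tens_balanced (linZ la) a1 -pzscalerAr mulr1 tensZl.
Qed.

Lemma mul_left_inverse_eq0 (A : pzRingType) (a b c : A) :
  a * b = 1 -> b * c = 0 -> c = 0.
Proof. by move=> ab bc; rewrite -[c]mul1r -ab -mulrA bc mulr0. Qed.

(** ** Multiplicativity of maps out of a localization *)

Section LocalizationHom.
Variables (F : fieldType) (I : Type) (L : algType F) (x xV : I -> L).
Variables (H A D : pzAlgebra F) (z : I -> H).
Variables (il : L -> A) (ih : H -> A) (jl : L -> D) (jh : H -> D) (phi : A -> D).
Hypothesis genL : generates (fun f : pz_of L =>
  (exists i, f = x i) \/ (exists i, f = xV i)).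
Hypothesis xVx : forall i, xV i * x i = 1.
Hypothesis xxV : forall i, x i * xV i = 1.
Hypothesis homil : @alg_hom F (pz_of L) A il.
Hypothesis homih : alg_hom ih.
Hypothesis homjl : @alg_hom F (pz_of L) D jl.
Hypothesis homjh : alg_hom jh.
Hypothesis lphi : linear phi.
Hypothesis spanA : forall W : submodule A, (forall f h, W (il f * ih h)) -> forall a, W a.
Hypothesis phiE : forall f h, phi (il f * ih h) = jl f * jh h.
Hypothesis ilx : forall i, il (x i) = ih (z i).

(** Call b good if phi(ab) = phi(a) phi(b) for all a.  Elements of H are good
    since right multiplication by them is visible on A = L H.  So is x_i, which
    comes from H; and x_i^-1 is good since
    phi(a) = phi(a x_i^-1 x_i) = phi(a x_i^-1) phi(x_i) and phi(x_i) is
    invertible.  Hence L, and with it A, is good. *)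
Lemma localization_hom : alg_hom phi.
Proof.
have [lf [f1 fM]] := homil; have [lh [h1 hM]] := homih.
have [_ [jl1 _]] := homjl; have [_ [jh1 jhM]] := homjh.
have phil f : phi (il f) = jl f by rewrite -[il f]mulr1 -h1 phiE jh1 mulr1.
have phih h : phi (ih h) = jh h by rewrite -[ih h]mul1r -f1 phiE jl1 mul1r.
have phi1 : phi 1 = 1 by rewrite -h1 phih jh1.
pose good (b : A) := forall a : A, phi (a * b) = phi a * phi b.
have good0 : good 0 by move=> a; rewrite mulr0 (lin0 lphi) mulr0.
have goodZD c u v : good u -> good v -> good (c *: u + v).
  by move=> gu gv a; rewrite (linear_mull a) !lphi gu gv (linear_mull (phi a)).
pose G := Submodule (V := A) good0 goodZD.
have goodM u v : good u -> good v -> good (u * v).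
  by move=> gu gv a; rewrite mulrA gv gu gv mulrA.
have goodh h : good (ih h).
  move=> a; have lin1 : linear (fun a : A => phi (a * ih h)).
    by move=> c u v; rewrite linear_mulr lphi.
  have lin2 : linear (fun a : A => phi a * phi (ih h)).
    by move=> c u v; rewrite lphi linear_mulr.
  apply: (spanA (W := eq_sub lin1 lin2)) => f h' /=.
  by rewrite -mulrA -hM !phiE phih jhM mulrA.
have goodx i : good (il (x i)) by rewrite ilx.
have goodV i : good (il (xV i)).
  move=> a; have := goodx i (a * il (xV i)).
  rewrite -mulrA (alg_homM_inv homil (xVx i)) mulr1 => ->.
  by rewrite !phil -mulrA (alg_homM_inv homjl (xxV i)) mulr1.
have goodl f : good (il f).
  suff goodl' : forall f : pz_of L, preim_sub lf G f by exact: goodl'.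
  apply: genL => /= [a|g f' gen gf']; first by rewrite f1 mulr1 phi1 mulr1.
  rewrite (fM g f'); apply: goodM gf'.
  by case: gen => -[i ->]; [apply: goodx | apply: goodV].
split=> //; split=> // a b; move: a.
by apply: (spanA (W := G)) => f h /=; apply: goodM; [apply: goodl | apply: goodh].
Qed.
End LocalizationHom.

(** ** The isomorphism Phi *)

Section Localization.
Variables (F : fieldType) (n : nat) (kappa : F).
Local Notation H := (rca n kappa).
Local Notation D := (ddaha n kappa).
Local Notation L := (laurent_alg F n).
Local Notation T := (loc_mod n kappa).
Local Notation ddl := (@ddaha_laurent F n kappa).
Local Notation lop := (@laurent_of_poly F n).
Local Notation X f := (rca_poly kappa f).
Local Notation s w := (rca_s kappa w).
Local Notation lt := (@loc_tens F n kappa).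

Variable iota : H -> D.
Hypothesis homi : alg_hom iota.
Hypothesis ispec : iota_spec iota.
Hypothesis iX : forall p, iota (X p) = ddl (lop p).
Hypothesis i_inj : injective iota.
Let homl := @ddaha_laurent_alg_hom F n kappa.

Lemma loc_tens_balanced f p h : lt (f * lop p) h = lt f (X p * h).
Proof. exact: (tens_balanced (L := pz_of L)). Qed.

Lemma exists_Phi : exists Phi : T -> D,
  linear Phi /\ forall f h, Phi (lt f h) = ddl f * iota h.
Proof.
have [ll [l1 lM]] := homl; have [li [i1 iM]] := homi.
apply: (@tensor_lift F (poly_alg F n) (pz_of L) H lop (@rca_poly F n kappa) D
  (fun f h => ddl f * iota h)) => [h c f g|f h h'|f p h].
- by rewrite ll linear_mulr.
- by rewrite (linD li) mulrDr.
- by rewrite [ddl _](lM f (lop p)) iM iX mulrA.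
Qed.

Variable Phi : T -> D.
Hypothesis lPhi : linear Phi.
Hypothesis PhiE : forall f h, Phi (lt f h) = ddl f * iota h.

Lemma loc_span (W : submodule T) : (forall f h, W (lt f h)) -> forall t, W t.
Proof. by move=> Wt; exact: (tens_span (L := pz_of L) Wt). Qed.

Lemma exponent_diff (e : {ffun 'I_n -> int}) :
  exists m m', e = - exponent m + exponent m'.
Proof.
exists [multinom (if e i is Negz k then k.+1 else 0%N) | i < n].
exists [multinom (if e i is Posz k then k else 0%N) | i < n].
apply/ffunP => i; rewrite !ffunE !mnmE; case: (e i) => k.
  by rewrite oppr0 add0r.
by rewrite NegzE addr0.
Qed.

Lemma loc_tens_linearl h : linear (lt^~ h).
Proof. exact: (tens_linear (L := pz_of L)). Qed.

Lemma loc_tensZr c f h : lt f (c *: h) = c *: lt f h.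
Proof.
exact: (@tensZr F (pz_of (poly_alg F n)) (pz_of L) H lop (@rca_poly F n kappa) c f h
  (@laurent_of_poly_alg_hom F n) (@rca_poly_alg_hom F n kappa)).
Qed.

Lemma loc_tens_linear f : linear (lt f).
Proof.
move=> c h h'; rewrite -loc_tensZr; exact: (tensDr (L := pz_of L)).
Qed.

Lemma loc_tens_monomial (e : {ffun 'I_n -> int}) m h :
  lt (lmon F (e + exponent m)) h = lt (lmon F e) (X 'X_[m] * h).
Proof.
rewrite (lmonD F e (exponent m)) -laurent_of_polyXm; exact: loc_tens_balanced.
Qed.

(** Each monomial is x^-m x^m', and x^m' can be moved across the tensor; two
    such expressions are brought to a common denominator. *)
Lemma common_denominator (t : T) :
  exists m h, t = lt (lmon F (- exponent m)) h.
Proof.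
pose Q (t : T) := exists m h, t = lt (lmon F (- exponent m)) h.
have Q0 : Q 0 by exists 0%MM, 0; rewrite (lin0 (loc_tens_linear _)).
have exponentD m m' : exponent (m + m') = exponent m + exponent m' :> {ffun 'I_n -> int}.
  by apply/ffunP => i; rewrite !ffunE mnmDE PoszD.
have widen m m' h :
    lt (lmon F (- exponent m)) h = lt (lmon F (- exponent (m + m'))) (X 'X_[m'] * h).
  by rewrite -loc_tens_monomial exponentD opprD subrK.
have QZD c u v : Q u -> Q v -> Q (c *: u + v).
  move=> [m [h ->]] [m' [h' ->]].
  exists (m + m')%MM, (c *: (X 'X_[m'] * h) + X 'X_[m] * h').
  by rewrite loc_tens_linear -widen addmC -widen.
apply: (loc_span (W := Submodule Q0 QZD)) => f h /=.
apply: (laurent_span (W := preim_sub (loc_tens_linearl h) (Submodule Q0 QZD))) => e /=.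
have [m [m' ->]] := exponent_diff e.
by exists m, (X 'X_[m'] * h); rewrite loc_tens_monomial.
Qed.

Lemma Phi_injective : injective Phi.
Proof.
suff ker0 t : Phi t = 0 -> t = 0.
  move=> t t' tt'; apply/eqP; rewrite -subr_eq0; apply/eqP/ker0.
  by rewrite (linB lPhi) tt' subrr.
have [m [h ->]] := common_denominator t; rewrite PhiE => eq0.
have inv : ddl (lmon F (exponent m)) * ddl (lmon F (- exponent m)) = 1.
  by apply: (alg_homM_inv homl); rewrite -lmonD subrr.
have ih0 : iota h = 0 := mul_left_inverse_eq0 inv eq0.
have -> : h = 0 by apply: i_inj; rewrite ih0 (lin0 homi.1).
exact: (lin0 (loc_tens_linear _)).
Qed.

Local Notation J := (smash_span ddl (@ddaha_s F n kappa)).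

Lemma commutator_ddaha_u i f : J (commutator (ddaha_u kappa i) (ddl f)).
Proof.
have s1 := @ddaha_s1 F n kappa; have sl := @ddaha_s_laurent F n kappa.
have Jx j w : J (ddaha_x kappa j * ddaha_s kappa w).
  exact: (smash_span_term ddl (@ddaha_s F n kappa) (lX F j) w).
have Jux j : J (commutator (ddaha_u kappa i) (ddaha_x kappa j)).
  case: (ltngtP i j) => [ij|ji|/val_inj <-].
  - rewrite (tr_lt (@ddaha_trig F n kappa)) //; exact: (sub_memN (Jx i _)).
  - rewrite (tr_gt (@ddaha_trig F n kappa)) //; exact: (sub_memN (Jx j _)).
  - rewrite (tr_eq (@ddaha_trig F n kappa)) -addrA.
    have Jxi : J (ddaha_x kappa i) by rewrite -[ddaha_x _ i]mulr1 -s1; exact: Jx.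
    apply: (sub_memZD kappa Jxi).
    by apply: (sub_memD (W := J)); apply: sub_mem_sum => k _; exact: Jx.
apply: (commutator_smash_span homl sl (@generates_laurent F n)) => _ [[j ->]|[j ->]].
  exact: Jux.
by apply: (smash_span_inverse homl sl (lX_lXV F j) _ (Jux j)); rewrite mulrC lX_lXV.
Qed.

(** The image is stable under left multiplication by the generators; for u_i
    by u_i f = f u_i + [u_i, f], where u_i is in the image of iota and the
    commutator in F[x^{+-1}] x| S_n. *)
Lemma Phi_surjective (d : D) : exists t, Phi t = d.
Proof.
have [ll [l1 lM]] := homl; have [li [i1 iM]] := homi; have [is_ ix iy] := ispec.
have R1 : exists t, Phi t = 1 by exists (lt 1 1); rewrite PhiE [ddl 1]l1 i1 mul1r.
pose R := range_sub lPhi.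
have RT f h : R (ddl f * iota h) by exists (lt f h); rewrite PhiE.
have Rl l d' : R d' -> R (ddl l * d').
  move=> [t <-].
  apply: (loc_span (W := preim_sub lPhi (preim_sub (linear_mull (ddl l)) R))).
  move=> f h /=; rewrite PhiE mulrA -[ddl l * _](lM l f); exact: RT.
have Rs w d' : R d' -> R (ddaha_s kappa w * d').
  move=> [t <-].
  apply: (loc_span (W := preim_sub lPhi (preim_sub (linear_mull (ddaha_s kappa w)) R))).
  move=> f h /=; rewrite PhiE mulrA ddaha_s_laurent -mulrA -is_ -iM; exact: RT.
have RJ j d' : J j -> R d' -> R (j * d').
  move=> Jj Rd; apply: (in_spanP (W := preim_sub (linear_mulr d') R) _ Jj).
  move=> _ [f [w ->]] /=; rewrite -mulrA; exact: (Rl f _ (Rs w _ Rd)).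
have Ru i d' : R d' -> R (ddaha_u kappa i * d').
  move=> [t <-].
  apply: (loc_span (W := preim_sub lPhi (preim_sub (linear_mull (ddaha_u kappa i)) R))).
  move=> f h /=; rewrite PhiE.
  have uE : ddaha_u kappa i = iota (rca_x kappa i * rca_y kappa i +
      \sum_(j : 'I_n | (j < i)%N) s (tperm j i)).
    have sumE : iota (\sum_(j : 'I_n | (j < i)%N) s (tperm j i)) =
        \sum_(j : 'I_n | (j < i)%N) ddaha_s kappa (tperm j i).
      by rewrite (lin_sum li); apply: eq_bigr => j _; exact: is_.
    rewrite (linD li) sumE (iM (rca_x kappa i)) ix iy.
    by rewrite mulrA (pt_XK (@ddaha_torus F n kappa)) mul1r subrK.
  have -> : ddaha_u kappa i * (ddl f * iota h) =
      commutator (ddaha_u kappa i) (ddl f) * iota h + ddl f * (ddaha_u kappa i * iota h).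
    by rewrite /commutator mulrBl -!mulrA subrK.
  have Rh : R (iota h) by rewrite -[iota h]mul1r -l1; exact: RT.
  have Rfu : R (ddl f * (ddaha_u kappa i * iota h)) by rewrite uE -iM; exact: RT.
  exact: (sub_memD (RJ _ _ (commutator_ddaha_u i f) Rh) Rfu).
apply: (@generates_ddaha F n kappa R) => //= _ d' [[i ->]|[[i ->]|[[w ->]|[i ->]]]] Rd.
- exact: (Rl (lX F i)).
- exact: (Rl (lXV F i)).
- exact: Rs.
- exact: Ru.
Qed.

Lemma Phi_laurent f : Phi (lt f 1) = ddl f.
Proof. by rewrite PhiE homi.2.1 mulr1. Qed.
Lemma Phi_rca h : Phi (lt 1 h) = iota h.
Proof. by rewrite PhiE [ddl 1](homl.2.1) mul1r. Qed.

Lemma exists_localization (Psi : D -> T) : cancel Phi Psi -> cancel Psi Phi ->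
  exists S : alg_structure T, is_localization S.
Proof.
move=> PhiK PsiK; have [S homPhi] := transport_structure lPhi PhiK PsiK.
have homPsi : @alg_hom F D (PzAlgebra S) Psi := inverse_alg_hom homPhi PhiK PsiK.
exists S; split.
- apply: (eq_alg_hom _ (alg_hom_comp homl homPsi)) => f /=.
  by apply: (can_inj PhiK); rewrite PsiK Phi_laurent.
- apply: (eq_alg_hom _ (alg_hom_comp homi homPsi)) => h /=.
  by apply: (can_inj PhiK); rewrite PsiK Phi_rca.
- move=> f h; apply: (can_inj PhiK); rewrite PhiE.
  exact: (alg_homME homPhi (Phi_laurent f) (Phi_rca h)).
Qed.

Lemma Phi_alg_hom (S : alg_structure T) : is_localization S ->
  @alg_hom F (PzAlgebra S) D Phi.
Proof.
move=> [homf homh mulE].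
have VX i : lXV F i * lX F i = (1 : L) := etrans (mulrC (lXV F i) (lX F i)) (lX_lXV F i).
apply: (@localization_hom F 'I_n L (@lX F n) (@lXV F n) H (PzAlgebra S) D
  (@rca_x F n kappa) (fun f => lt f 1) (fun h => lt 1 h) ddl iota Phi
  (@generates_laurent F n) VX (@lX_lXV F n) homf homh homl homi lPhi).
- move=> W Wt; apply: (loc_span (W := W)) => f h; rewrite -mulE; exact: Wt.
- move=> f h; rewrite mulE; exact: PhiE.
- move=> i; rewrite -laurent_of_polyX -[laurent_of_poly _]mul1r loc_tens_balanced.
  by rewrite mulr1.
Qed.
End Localization.

(** * The isomorphism and its inverse *)

Section Inverse.
Variables (F : fieldType) (n : nat) (kappa : F).
Variable iota : rca n kappa -> ddaha n kappa.
Hypothesis homi : alg_hom iota.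
Hypothesis ispec : iota_spec iota.
Variable S : alg_structure (loc_mod n kappa).
Variables (Phi : PzAlgebra S -> ddaha n kappa) (jmath : ddaha n kappa -> PzAlgebra S).
Hypothesis homPhi : alg_hom Phi.
Hypothesis Phil : forall f, Phi (loc_tens f 1) = ddaha_laurent kappa f.
Hypothesis Phir : forall h, Phi (loc_tens 1 h) = iota h.
Hypothesis PhiK : cancel Phi jmath.
Hypothesis jmathK : cancel jmath Phi.

Lemma inverse_jmath_spec : jmath_spec jmath.
Proof.
have [is_ ix iy] := ispec; have [lP [_ PM]] := homPhi.
split=> [w|i|i]; apply: (can_inj PhiK); rewrite jmathK.
- by rewrite Phir is_.
- by rewrite Phil.
- rewrite (linD lP) (lin_sum lP) (alg_homME homPhi (Phil (lX F i)) (Phir (rca_y kappa i))).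
  under eq_bigr => j _ do rewrite Phir is_.
  have XV : ddaha_laurent kappa (lX F i) * ddaha_xV kappa i = 1.
    exact: (pt_XK (@ddaha_torus F n kappa) i).
  by rewrite iy mulrA XV mul1r subrK.
Qed.
End Inverse.

Theorem proposition3p1 (F : closedFieldType) (charF0 : [pchar F] =i pred0)
    (n : nat) (n_ge2 : (2 <= n)%N) (kappa : F) (kappa_neq0 : kappa != 0) :
  exists iota : rca n kappa -> ddaha n kappa,
    [/\ alg_hom iota /\ iota_spec iota,
        forall iota' : rca n kappa -> ddaha n kappa,
          alg_hom iota' -> iota_spec iota' -> iota' =1 iota,
        injective iota
      & (exists S : alg_structure (loc_mod n kappa), is_localization S) /\
        forall S : alg_structure (loc_mod n kappa), is_localization S ->
        exists (Phi : PzAlgebra S -> ddaha n kappa)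
               (jmath : ddaha n kappa -> PzAlgebra S),
          [/\ alg_hom Phi /\ (forall h : rca n kappa,
                                Phi (loc_tens 1 h) = iota h),
              cancel Phi jmath, cancel jmath Phi
            & alg_hom jmath /\ jmath_spec jmath]].
Proof.
have [iota [homi ispec iX]] := exists_iota n kappa.
have i_inj := iota_injective homi ispec iX.
have [Phi [lPhi PhiE]] := exists_Phi homi iX.
have Phi_inj := Phi_injective homi i_inj lPhi PhiE.
have Phi_surj := Phi_surjective homi ispec lPhi PhiE.
pose Psi d := projT1 (cid (Phi_surj d)).
have PsiK : cancel Psi Phi by move=> d; exact: (projT2 (cid (Phi_surj d))).
have PhiK : cancel Phi Psi by move=> t; apply: Phi_inj; rewrite PsiK.
exists iota; split.
- by split.
- move=> iota' homi' [is' ix' iy']; have [is_ ix iy] := ispec.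
  apply: (alg_hom_ext (@generates_rca F n kappa) homi' homi).
  move=> _ [[i ->]|[[w ->]|[i ->]]].
  + exact: etrans (ix' i) (esym (ix i)).
  + exact: etrans (is' w) (esym (is_ w)).
  + exact: etrans (iy' i) (esym (iy i)).
- exact: i_inj.
split; first exact: (exists_localization homi lPhi PhiE PhiK PsiK).
move=> S locS.
have homPhi := Phi_alg_hom homi lPhi PhiE locS.
have homPsi := inverse_alg_hom homPhi PhiK PsiK.
have Phir := Phi_rca PhiE; have Phil := Phi_laurent homi PhiE.
exists Phi, Psi; split; [split; [exact: homPhi | exact: Phir] | exact: PhiK | exact: PsiK | split].
  exact: homPsi.
exact: (inverse_jmath_spec ispec homPhi Phil Phir PhiK PsiK).
Qed.
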